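(* Let $\Bbbk$ be a field, $S=\Bbbk[x_1,\dots,x_n]$, $i\in[n]$, $j\in\mathbb{Z}$ and $M\in\mathrm{mod}_{\mathbb{Z}^n}S$. Then $$\operatorname{sdepth}_S M=\operatorname{sdepth}_S M^{\triangleleft\langle i,j\rangle}.$$ Consequently, $\operatorname{sdepth}_S M\ge\operatorname{depth}_S M$ holds if and only if $\operatorname{sdepth}_S M^{\triangleleft\langle i,j\rangle}\ge\operatorname{depth}_S M^{\triangleleft\langle i,j\rangle}$ holds.
   Context: $S$ is $\mathbb{Z}^n$-graded with $\deg x_k=\mathbf{e}_k$; $\mathrm{mod}_{\mathbb{Z}^n}S$ is the category of finitely generated $\mathbb{Z}^n$-graded $S$-modules. For $\mathbf{a}\in\mathbb{Z}^n$, $a_k$ is its $k$-th coordinate. For an order-preserving $q:\mathbb{Z}^n\to\mathbb{Z}^n$, $q^*M$ has $(q^*M)_{\mathbf{a}}=M_{q(\mathbf{a})}$, multiplication by $x^{\mathbf{b}}$ from degree $\mathbf{a}$ to $\mathbf{a}+\mathbf{b}$ being multiplication by $x^{q(\mathbf{a}+\mathbf{b})-q(\mathbf{a})}$ in $M$. The map $\sigma_{\langle i,j\rangle}$ fixes coordinates $k\ne i$ and $(\sigma_{\langle i,j\rangle}(\mathbf{a}))_i=a_i-1$ if $a_i\ge j$, $a_i$ if $a_i<j$; $M^{\triangleleft\langle i,j\rangle}:=(\sigma_{\langle i,j\rangle})^*M$. Stanley depth: for $Z\subset\{x_1,\dots,x_n\}$, $\Bbbk[Z]$ is the subalgebra generated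 by $Z$. For a homogeneous $m\in M$, $m\Bbbk[Z]$ is a Stanley space if it is a free $\Bbbk[Z]$-module. A Stanley decomposition of $M$ is a finite direct sum decomposition $M=\bigoplus_{l=1}^s m_l\Bbbk[Z_l]$ as $\mathbb{Z}^n$-graded $\Bbbk$-vector spaces with each $m_l\Bbbk[Z_l]$ a Stanley space; its Stanley depth is $\min_l\#Z_l$, and $\operatorname{sdepth}_S M$ is the maximum of the Stanley depths of all Stanley decompositions of $M$ (for $M\ne 0$). *)

(* Defs.v *)
From HB Require Import structures.
From mathcomp Require Import all_boot all_order all_algebra.
From mathcomp Require Import mpoly zify.
From Stdlib Require Import ClassicalEpsilon.
Set Implicit Arguments. Unset Strict Implicit. Unset Printing Implicit Defensive.
Import Order.TTheory GRing.Theory Num.Theory.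
Local Open Scope ring_scope.

Definition deg (n : nat) := 'I_n -> int.

Definition dle (n : nat) (a c : deg n) : bool := [forall k, a k <= c k].

Definition pb (P : Prop) : bool :=
  if excluded_middle_informative P then true else false.

(* A Z^n-graded S-module, S = K[x_1..x_n] with deg x_k = e_k, given by its
   homogeneous components M_a (K-vector spaces) and, for a <= c, the K-linear
   multiplication map  x^(c-a) : M_a -> M_c  (gmul a c; meaningless when
   a is not <= c).  Functoriality encodes associativity and commutativity of the
   action of the monomials. *)
Record grmod (K : fieldType) (n : nat) := GrMod {
  gcomp :> deg n -> lmodType K;
  gmul : forall a c : deg n, gcomp a -> gcomp c;
  gmulD : forall a c (u v : gcomp a), gmul c (u + v) = gmul c u + gmul c v;
  gmulZ : forall a c (k : K) (u : gcomp a), gmul c (k *: u) = k *: gmul c u;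
  gmul_id : forall a (u : gcomp a), gmul a u = u;
  gmul_comp : forall a b c (u : gcomp a), dle a b -> dle b c ->
      gmul c (gmul b u) = gmul c u
}.
Arguments gmul {K n} g a c _.

Section Defs.
Variables (K : fieldType) (n : nat).

Definition fin_gen (M : grmod K n) : Prop :=
  exists (s : nat) (d : 'I_s -> deg n) (g : forall l, M (d l)),
    forall (a : deg n) (v : M a), exists c : 'I_s -> K,
      v = \sum_(l < s | dle (d l) a) c l *: gmul M (d l) a (g l).

Definition nonzero (M : grmod K n) : Prop := exists (a : deg n) (v : M a), v != 0.

Definition pullback (q : deg n -> deg n)
    (qmono : forall a c, dle a c -> dle (q a) (q c)) (M : grmod K n) : grmod K n.
Proof.
refine (@GrMod K n (fun a => M (q a)) (fun a c u => gmul M (q a) (q c) u) _ _ _ _).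
- by move=> a c u v; apply: gmulD.
- by move=> a c k u; apply: gmulZ.
- by move=> a u; apply: gmul_id.
- by move=> a b c u ab bc; apply: gmul_comp; apply: qmono.
Defined.

Definition sigma (i : 'I_n) (j : int) (a : deg n) : deg n :=
  fun k => if k == i then (if j <= a k then a k - 1 else a k) else a k.

Lemma sigma_mono (i : 'I_n) (j : int) a c :
  dle a c -> dle (sigma i j a) (sigma i j c).
Proof.
move=> /forallP H; apply/forallP => k; rewrite /sigma.
case: (k == i); last exact: H.
have := H k; case: (leP j (a k)); case: (leP j (c k)) => ?? ?; lia.
Qed.

Definition shiftmod (M : grmod K n) (i : 'I_n) (j : int) : grmod K n :=
  pullback (@sigma_mono i j) M.

(* degree a lies in d + N^Z (the degrees of the Stanley space m K[Z], deg m = d) *)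
Definition in_cone (d : deg n) (Z : {set 'I_n}) (a : deg n) : bool :=
  [forall k, (d k <= a k) && ((k \in Z) || (a k == d k))].

(* m K[Z] is a Stanley space (free K[Z]-module): x^b m <> 0 for all b in N^Z *)
Definition stanley_space (M : grmod K n) (d : deg n) (m : M d) (Z : {set 'I_n}) :=
  forall a, in_cone d Z a -> gmul M d a m != 0.

(* M = (+)_l m_l K[Z_l] as Z^n-graded K-vector spaces: in every degree a, the
   homogeneous pieces (m_l K[Z_l])_a = K x^(a - d_l) m_l  (for a in d_l + N^Z_l)
   form a direct sum decomposition of M_a. *)
Definition stanley_dec (M : grmod K n) (s : nat) (d : 'I_s -> deg n)
    (m : forall l, M (d l)) (Z : 'I_s -> {set 'I_n}) : Prop :=
  (forall l, stanley_space (m l) (Z l)) /\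
  forall a : deg n,
    (forall v : M a, exists c : 'I_s -> K,
        v = \sum_(l < s | in_cone (d l) (Z l) a) c l *: gmul M (d l) a (m l)) /\
    (forall c : 'I_s -> K,
        \sum_(l < s | in_cone (d l) (Z l) a) c l *: gmul M (d l) a (m l) = 0 ->
        forall l, in_cone (d l) (Z l) a -> c l = 0).

Definition sdec_depth (s : nat) (Z : 'I_s -> {set 'I_n}) : nat :=
  \big[minn/n]_(l < s) #|Z l|.

(* sdepth_S M = max of the Stanley depths of all Stanley decompositions
   (all such depths are <= n) *)
Definition sdepth (M : grmod K n) : nat :=
  \max_(r < n.+1 | pb (exists s d m Z, @stanley_dec M s d m Z /\ r <= sdec_depth Z)%N) r.

(* elements of the module M = (+)_a M_a: finitely supported families *)
Definition finsupp (M : grmod K n) (v : forall a, M a) : Prop :=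
  exists s : seq (deg n), forall a, v a != 0 -> has (fun b => [forall k, b k == a k]) s.

Definition subdeg (a : deg n) (b : 'X_{1..n}) : deg n := fun k => a k - (b k)%:Z.

Definition polyact (M : grmod K n) (f : {mpoly K[n]}) (v : forall a, M a) :
    forall a, M a :=
  fun a => \sum_(b <- msupp f) f@_b *: gmul M (subdeg a b) a (v (subdeg a b)).

Definition in_idealmod (M : grmod K n) (fs : seq {mpoly K[n]}) (v : forall a, M a) :=
  exists gs : 'I_(size fs) -> forall a, M a,
    (forall j, finsupp (gs j)) /\
    forall a, v a = \sum_(j < size fs) polyact (nth 0 fs j) (gs j) a.

Definition regseq (M : grmod K n) (fs : seq {mpoly K[n]}) : Prop :=
  [/\ forall f, f \in fs -> f@_0%MM = 0,
      forall (i : 'I_(size fs)) (v : forall a, M a), finsupp v ->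
         in_idealmod (take i fs) (polyact (nth 0 fs i) v) ->
         in_idealmod (take i fs) v
    & exists v : forall a, M a, finsupp v /\ ~ in_idealmod fs v].

(* depth_S M = maximal length of an M-regular sequence in m (always <= n) *)
Definition depth (M : grmod K n) : nat :=
  \max_(r < n.+1 | pb (exists fs, size fs = r /\ regseq M fs)) r.

End Defs.

(* Main.v *)
Require Import Defs.
From HB Require Import structures.
From mathcomp Require Import all_boot all_order all_algebra.
From mathcomp Require Import mpoly boolp zify ring.
Set Implicit Arguments. Unset Strict Implicit. Unset Printing Implicit Defensive.
Import Order.TTheory GRing.Theory Num.Theory.
Local Open Scope ring_scope.

(** Stanley decompositions pull back along an order-preserving map [q] as soon
    as the preimage under [q] of a cone is a finite disjoint union of cones with
    the same free directions. This holds for [sigma] and for its section [skip],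
    which recovers [M] from its shift; hence the equality of Stanley depths.

    The depths are equal as well. The Koszul complex on [x_1, ..., x_n] is
    depth-sensitive: [M] has a regular sequence of length [r] in the maximal
    ideal iff the Koszul cohomology of [M] vanishes in degrees [< r].
    The quotients by non-homogeneous sequences are no longer graded; there a
    regular element is found without associated primes: if [x], [y] have no common
    socle, then among infinitely many pairwise coprime polynomials in [x], [y] one
    is regular, since otherwise their kernels would form an infinite direct sum.

    Build the Koszul complex as the cone of [x_i] on the complex of the other variables. The shift
    inserts into [x_i : M -> M] one additional isomorphism (between degrees
    [j - 1] and [j] in direction [i]), so that the cone of [M] is a direct summand
    of the cone of the shift, with contractible complement. *)

(** * Regular elements modulo a submodule of a Noetherian module *)

Section RegularElements.
Variables (R : comNzRingType) (V : lmodType R).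
Implicit Types (L T : V -> Prop) (xs : seq R).

Definition submodule L :=
  [/\ L 0, forall u v, L u -> L v -> L (u + v) & forall r v, L v -> L (r *: v)].

Lemma submoduleN L : submodule L -> forall v, L v -> L (- v).
Proof. by case=> _ _ LZ v /(LZ (-1)); rewrite scaleN1r. Qed.

Lemma submoduleB L : submodule L -> forall u v, L u -> L v -> L (u - v).
Proof. by move=> sL u v Lu /(submoduleN sL); case: sL => _ LD _; exact: LD. Qed.

Lemma submodule_sum L : submodule L ->
  forall (k : nat) (F : 'I_k -> V), (forall j, L (F j)) -> L (\sum_j F j).
Proof. by case=> L0 LD _ k F LF; apply: (big_ind L) => // j _; exact: LF. Qed.

(** Each ascending chain is only asked for one step without growth; since this holds for subchains
    too, it amounts to stabilization. *)
Definition noetherian := forall L : nat -> V -> Prop,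
  (forall s, submodule (L s)) -> (forall s v, L s v -> L s.+1 v) ->
  exists s, forall v, L s.+1 v -> L s v.

(** Quotients are never formed: this says on representatives that [f] is a nonzerodivisor on
    [V / L]. *)
Definition regular_mod f L := forall v, L (f *: v) -> L v.

Fixpoint in_ideal xs (f : R) : Prop :=
  if xs is x :: xs' then exists h f', f = h * x + f' /\ in_ideal xs' f' else f = 0.

Lemma in_ideal0 xs : in_ideal xs 0.
Proof. by elim: xs => //= x xs IH; exists 0, 0; rewrite mul0r addr0. Qed.

Lemma in_idealD xs f g : in_ideal xs f -> in_ideal xs g -> in_ideal xs (f + g).
Proof.
elim: xs f g => /= [f g -> ->|x xs IH f g]; first by rewrite addr0.
move=> [h [f' [-> If]]] [k [g' [-> Ig]]]; exists (h + k), (f' + g').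
by split; [rewrite mulrDl addrACA|apply: IH].
Qed.

Lemma in_idealM xs r f : in_ideal xs f -> in_ideal xs (r * f).
Proof.
elim: xs f => /= [f ->|x xs IH f]; first by rewrite mulr0.
move=> [h [f' [-> If]]]; exists (r * h), (r * f').
by split; [rewrite mulrDr mulrA|apply: IH].
Qed.

Lemma mem_in_ideal xs x : x \in xs -> in_ideal xs x.
Proof.
elim: xs => //= y xs IH; rewrite inE => /orP[/eqP->|/IH Ix].
  by exists 1, 0; rewrite mul1r addr0; split=> //; exact: in_ideal0.
by exists 0, x; rewrite mul0r add0r.
Qed.

(** * Pairwise coprime combinations of two elements *)

Section Pair.
Variables x y : R.

(* Any two of these elements generate an ideal containing [y] and a power
   of [x]. *)
Fixpoint coprime_prod (t : nat) : R :=
  if t is s.+1 then coprime_prod s * (y + x * coprime_prod s) else x.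
(** As in Euclid's proof that there are infinitely many primes, [coprime_prod t] is [x] times the
    product of all [coprime_elt s] with [s < t]. *)
Definition coprime_elt t := y + x * coprime_prod t.

Lemma coprime_prodS t s : (t < s)%N ->
  exists c, coprime_prod s = c * coprime_elt t.
Proof.
elim: s => // s IH; rewrite ltnS leq_eqVlt => /orP[/eqP ->|/IH[c /= E]].
  by exists (coprime_prod s).
by rewrite /= {1}E; exists (c * (y + x * coprime_prod s)); rewrite mulrAC.
Qed.

Lemma coprime_prod_expr t : exists d c, coprime_prod t = x ^+ d + c * y.
Proof.
elim: t => [|t [d [c E]]] /=; first by exists 1%N, 0; rewrite mul0r addr0 expr1.
exists (d + d.+1)%N, (x ^+ d.+1 * c + c * (y + x * coprime_prod t) + x ^+ d).
by rewrite E; rewrite exprD exprS; ring.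
Qed.

Variable T : V -> Prop.
Hypotheses (sT : submodule T)
  (xyT : forall v, T (x *: v) -> T (y *: v) -> T v).

Lemma coprime_elt_inj t s v : t != s ->
  T (coprime_elt t *: v) -> T (coprime_elt s *: v) -> T v.
Proof.
wlog lt_ts : t s / (t < s)%N.
  move=> W; rewrite neq_ltn => /orP[lt_ts|lt_st] Tt Ts.
    by apply: (W t s) => //; rewrite neq_ltn lt_ts.
  by apply: (W s t) => //; rewrite neq_ltn lt_st.
move=> _ Tt Ts; have [T0 TD TZ] := sT.
have Ty : T (y *: v).
  have [c E] := coprime_prodS lt_ts.
  have -> : y *: v = coprime_elt s *: v - (x * c) *: (coprime_elt t *: v).
    by rewrite scalerA -scalerBl /(coprime_elt s) E mulrA addrK.
  by apply: submoduleB => //; apply: TZ.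
have [d [c E]] := coprime_prod_expr t.
have : T (x ^+ d.+1 *: v).
  have -> : x ^+ d.+1 *: v
     = coprime_elt t *: v - (1 + x * c) *: (y *: v).
    rewrite scalerA -scalerBl /coprime_elt E; congr (_ *: v).
    by rewrite exprS; ring.
  by apply: submoduleB => //; apply: TZ.
(* The power of [x] is peeled off one factor at a time: [x] and [y] both send [x ^+ e *: v] into
   [T], so [xyT] applies to it. *)
elim: d.+1 => [|e IH]; first by rewrite scale1r.
rewrite exprS -scalerA => Te; apply: IH; apply: xyT => //.
by rewrite scalerA mulrC -scalerA; apply: TZ.
Qed.

(** The kernels of the elements on [V / T] are independent: multiplication by [coprime_elt k]
    removes the last summand, induction settles the multiples of the others, and [coprime_elt_inj]
    removes the factor. *)
Lemma coprime_elt_sum k (u : nat -> V) :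
  (forall t, (t < k)%N -> T (coprime_elt t *: u t)) ->
  T (\sum_(t < k) u t) -> forall t, (t < k)%N -> T (u t).
Proof.
have [T0 TD TZ] := sT.
elim: k u => // k IH u Tu Tsum.
have lt_k t : (t < k)%N -> T (u t).
  move=> tk; have : T (coprime_elt k *: u t).
    apply: (IH (fun t => coprime_elt k *: u t)) => // [s sk|].
      by rewrite scalerA mulrC -scalerA; apply/TZ/Tu/leqW.
    rewrite -scaler_sumr.
    have -> : \sum_(i < k) u i = \sum_(i < k.+1) u i - u k.
      by rewrite big_ord_recr /= addrK.
    by rewrite scalerBr; apply: submoduleB => //; [apply: TZ|apply: Tu].
  by apply: (@coprime_elt_inj t k); [rewrite ltn_eqF|apply/Tu/leqW].
move=> t; rewrite ltnS leq_eqVlt => /orP[/eqP->|/lt_k//].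
have -> : u k = \sum_(i < k.+1) u i - \sum_(i < k) u i.
  by rewrite big_ord_recr /= addrAC subrr add0r.
by apply: submoduleB => //; apply: submodule_sum => // j; apply: lt_k.
Qed.

(** Otherwise each element kills some [w t] outside [T] modulo [T]. By independence the submodules
    generated by [T] and [w 0, ..., w (k - 1)] increase strictly with [k]. *)
Lemma exists_regular_pair : noetherian -> exists t, regular_mod (coprime_elt t) T.
Proof.
move=> noeV; apply: contrapT => /forallNP nreg.
have /choice[w wP] t : exists v, T (coprime_elt t *: v) /\ ~ T v.
  by have /existsNP[v /not_implyP[? ?]] := nreg t; exists v.
have [T0 TD TZ] := sT.
pose U k v := exists z (r : nat -> R), T z /\ v = z + \sum_(t < k) r t *: w t.
have [k|k v [z [r [Tz ->]]]|k Uk] := noeV U.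
- split=> [|_ _ [z [r [Tz ->]]] [z' [r' [Tz' ->]]]|a _ [z [r [Tz ->]]]].
  + by exists 0, (fun=> 0); split=> //; rewrite big1 ?addr0 // => t; rewrite scale0r.
  + exists (z + z'), (fun t => r t + r' t); split; first exact: TD.
    rewrite addrACA -big_split; congr (_ + _).
    by apply: eq_bigr => t _; rewrite scalerDl.
  + exists (a *: z), (fun t => a * r t); split; first exact: TZ.
    rewrite scalerDr scaler_sumr; congr (_ + _).
    by apply: eq_bigr => t _; rewrite scalerA.
- exists z, (fun t => if (t < k)%N then r t else 0); split=> //.
  rewrite big_ord_recr /= ltnn scale0r addr0; congr (_ + _).
  by apply: eq_bigr => t _; rewrite ltn_ord.
- have [z [r [Tz E]]] : U k (w k).
    apply: Uk; exists 0, (fun t => (t == k)%:R); split=> //.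
    rewrite big_ord_recr /= eqxx scale1r big1 ?addr0 ?add0r // => t _.
    by rewrite ltn_eqF // scale0r.
  (* Multiplying the expression of [w k] by [coprime_elt k] kills its left-hand side modulo [T] and
     leaves a relation among the earlier kernels. *)
  have Tsum : T (coprime_elt k *: \sum_(t < k) r t *: w t).
    have -> : \sum_(t < k) r t *: w t = w k - z by rewrite {1}E addrAC subrr add0r.
    by rewrite scalerBr; apply: submoduleB => //; [have [] := wP k|exact: TZ].
  have Tk t : (t < k)%N -> T (coprime_elt k *: (r t *: w t)).
    apply: (coprime_elt_sum (u := fun t => coprime_elt k *: (r t *: w t))).
      move=> s _; rewrite scalerA mulrC -scalerA; apply/TZ.
      rewrite scalerA mulrC -scalerA; apply/TZ.
      by have [] := wP s.
    by rewrite -scaler_sumr.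
  have [_] := wP k; apply; rewrite E; apply: TD => //.
  apply: submodule_sum => // t.
  apply: (@coprime_elt_inj t k); first by rewrite ltn_eqF.
    by rewrite scalerA mulrC -scalerA; apply: TZ; have [] := wP t.
  exact: Tk.
Qed.
End Pair.

(** For a submodule [T] this is the colon [T : I^s], where [I] is the ideal generated by [xs]. *)
Fixpoint colon_iter xs (T : V -> Prop) (s : nat) (v : V) : Prop :=
  if s is s'.+1 then forall y, y \in xs -> colon_iter xs T s' (y *: v) else T v.

Lemma submodule_colon_iter xs T s : submodule T -> submodule (colon_iter xs T s).
Proof.
move=> sT; elim: s => //= s [I0 ID IZ]; split=> [y _|u v Iu Iv y xy|r v Iv y xy].
- by rewrite scaler0.
- by rewrite scalerDr; apply: ID; [apply: Iu|apply: Iv].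
- by rewrite scalerA mulrC -scalerA; apply/IZ/Iv.
Qed.

Lemma colon_iterS xs T s v : submodule T ->
  colon_iter xs T s v -> colon_iter xs T s.+1 v.
Proof.
move=> sT; elim: s v => [|s IH] v /= Iv y xy; last by apply: IH; apply: Iv.
by case: sT => _ _; apply.
Qed.

Lemma colon_iter_leq xs T s s' v : submodule T -> (s <= s')%N ->
  colon_iter xs T s v -> colon_iter xs T s' v.
Proof.
move=> sT /subnK <-; elim: (s' - s)%N => // e IH /IH.
by rewrite addSn; exact: colon_iterS.
Qed.

(** Induction on the generators, replacing prime avoidance. The saturation [T'] of [T] by the ideal
    of [xs] has no socle for [xs], so some [f] in that ideal is regular modulo [T']. Then [f] and
    [x] have no common socle modulo [T], and the case of a pair applies. *)
Lemma exists_regular xs T : noetherian -> submodule T ->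
  (forall v, (forall x, x \in xs -> T (x *: v)) -> T v) ->
  exists2 f, in_ideal xs f & regular_mod f T.
Proof.
move=> noeV; elim: xs T => [|x xs IH] T sT xsT.
  by exists 0 => // v _; apply: xsT.
pose T' v := exists s, colon_iter xs T s v.
have sT' : submodule T'.
  split; first by exists 0%N; case: sT.
    move=> u v [s Iu] [s' Iv]; exists (maxn s s').
    have [_ ID _] := submodule_colon_iter xs (maxn s s') sT.
    by apply: ID; [apply: colon_iter_leq Iu|apply: colon_iter_leq Iv];
       rewrite // (leq_maxl, leq_maxr).
  move=> r v [s Iv]; exists s.
  by have [_ _ IZ] := submodule_colon_iter xs s sT; apply: IZ.
have [v xsT'v|f If regf] := IH T' sT'.
  (* Finitely many generators admit a common exponent, which puts [v] itself in the saturation. *)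
  suff bound (zs : seq R) : (forall y, y \in zs -> T' (y *: v)) ->
      exists N, forall y, y \in zs -> colon_iter xs T N (y *: v).
    by have [N NP] := bound xs xsT'v; exists N.+1.
  elim: zs => [|y zs IHs] T'y; first by exists 0%N.
  have [N NP] := IHs (fun z zzs => T'y z (mem_behead (s := y :: zs) zzs)).
  have [s sP] := T'y y (mem_head _ _).
  exists (maxn N s) => z; rewrite inE => /orP[/eqP->|/NP Iz].
    by apply: colon_iter_leq sP; rewrite // leq_maxr.
  by apply: colon_iter_leq Iz; rewrite // leq_maxl.
have [v Tf Tx|t regt] := exists_regular_pair (x := f) (y := x) sT _ noeV.
  have [s] : T' v by apply: regf; exists 0%N.
  (* Descent on the exponent: each [z *: v] with [z] in [xs] is still sent into [T] by [x] and has a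
     smaller exponent, so it lies in [T]; the socle hypothesis then gives [T v]. *)
  elim: s v {Tf} Tx => // s IHs v Tx /= Iv.
  apply: xsT => z; rewrite inE => /orP[/eqP->//|zxs].
  apply: IHs; last exact: Iv.
  by rewrite scalerA mulrC -scalerA; case: sT => _ _; apply.
exists (coprime_elt f x t) => //.
exists 1, (coprime_prod f x t * f); split; last exact: in_idealM.
by rewrite mul1r mulrC.
Qed.
End RegularElements.

(** * The Koszul complex *)

Section KoszulComplex.
Variables (R : comNzRingType) (V : lmodType R).

(* The complex of [x :: xs] is the cone of [x] on the complex of [xs]; all
   cohomological degrees are collected in one module and separated by
   [homogeneous]. *)
Fixpoint koszul (xs : seq R) : lmodType R :=
  if xs is _ :: xs' then (koszul xs' * koszul xs')%type else V.

Fixpoint kd (xs : seq R) : koszul xs -> koszul xs :=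
  match xs with
  | [::] => fun=> 0
  | x :: xs' => fun c => (kd c.1, x *: c.1 - kd c.2)
  end.

(** For a submodule [L], the cochains with [entries L] are those that vanish in the Koszul complex
    of [V / L]. *)
Fixpoint entries (P : V -> Prop) (xs : seq R) : koszul xs -> Prop :=
  match xs with
  | [::] => P
  | _ :: xs' => fun c => entries P c.1 /\ entries P c.2
  end.

(** Degrees are integers so that [p - 1] makes sense everywhere; in negative degrees only zero is
    homogeneous. *)
Fixpoint homogeneous (xs : seq R) (p : int) : koszul xs -> Prop :=
  match xs with
  | [::] => fun v => p = 0 \/ v = 0
  | _ :: xs' => fun c => homogeneous p c.1 /\ homogeneous (p - 1) c.2
  end.

Implicit Types (xs : seq R) (L : V -> Prop) (p : int).

Lemma kdD xs (b c : koszul xs) : kd (b + c) = kd b + kd c.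
Proof.
elim: xs b c => [b c|x xs IH [u w] [u' w']] /=; first by rewrite addr0.
by rewrite !IH scalerDr opprD addrACA.
Qed.

Lemma kdZ xs r (c : koszul xs) : kd (r *: c) = r *: kd c.
Proof.
elim: xs c => [c|x xs IH [u w]] /=; first by rewrite scaler0.
rewrite !IH; congr (_, _).
by rewrite scalerBr !scalerA mulrC.
Qed.

Lemma kd0 xs : kd (0 : koszul xs) = 0.
Proof. by rewrite -(scale0r 0) kdZ !scale0r. Qed.

Lemma kdN xs (c : koszul xs) : kd (- c) = - kd c.
Proof. by rewrite -scaleN1r kdZ scaleN1r. Qed.

Lemma kdB xs (b c : koszul xs) : kd (b - c) = kd b - kd c.
Proof. by rewrite kdD kdN. Qed.

Lemma kd_kd xs (c : koszul xs) : kd (kd c) = 0.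
Proof.
elim: xs c => [|x xs IH [u w]] //=.
by rewrite kdB kdZ !IH subr0 subrr.
Qed.

Lemma submodule_entries L xs : submodule L -> submodule (@entries L xs).
Proof.
move=> sL; elim: xs => //= x xs [I0 ID IZ]; split=> //=.
  by move=> u v [? ?] [? ?]; split; apply: ID.
by move=> r v [? ?]; split; apply: IZ.
Qed.

Lemma submodule_homogeneous xs p : submodule (@homogeneous xs p).
Proof.
elim: xs p => [p|x xs IH p] /=.
  split; first by right.
    by move=> u v [->|->]; [left|rewrite add0r].
  by move=> r v [->|->]; [left|rewrite scaler0; right].
have [H0 HD HZ] := IH p; have [G0 GD GZ] := IH (p - 1); split=> //=.
  by move=> u v [? ?] [? ?]; split; [apply: HD|apply: GD].
by move=> r v [? ?]; split; [apply: HZ|apply: GZ].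
Qed.

Lemma homogeneous_kd xs p (c : koszul xs) :
  homogeneous p c -> homogeneous (p + 1) (kd c).
Proof.
elim: xs p c => [p c _|x xs IH p [u w] [/= hu hw]]; first by right.
split; first exact: IH.
rewrite addrK; apply: submoduleB; first exact: submodule_homogeneous.
  by have [_ _] := submodule_homogeneous xs p; apply.
by rewrite -(subrK 1 p); apply: IH.
Qed.

Lemma entries_kd L xs (c : koszul xs) : submodule L -> entries L c -> entries L (kd c).
Proof.
move=> sL; elim: xs c => [c _|x xs IH [u w] [/= eu ew]]; first by case: sL.
split; first exact: IH.
apply: submoduleB; [exact: submodule_entries| |exact: IH].
by have [_ _] := submodule_entries xs sL; apply.
Qed.

Lemma homogeneous_lt0 xs p (c : koszul xs) : (p < 0)%R -> homogeneous p c -> c = 0.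
Proof.
elim: xs p c => [p c p0 [p1|->]|x xs IH p [u w] p0 [/= hu hw]] //; first by lia.
by rewrite (IH p u) // (IH (p - 1) w) //; lia.
Qed.

(* An element of the ideal acts null-homotopically, by the contraction
   built from an expression of it in the generators. *)
Lemma koszul_homotopy xs f : in_ideal xs f -> exists iota : koszul xs -> koszul xs,
  [/\ forall b c, iota (b + c) = iota b + iota c,
      forall r c, iota (r *: c) = r *: iota c,
      forall c, f *: c = kd (iota c) + iota (kd c),
      forall L c, submodule L -> entries L c -> entries L (iota c)
    & forall p c, homogeneous p c -> homogeneous (p - 1) (iota c)].
Proof.
elim: xs f => /= [f ->|x xs IH f [h [f' [-> /IH[io [ioD ioZ ioE ioL ioh]]]]]].
  exists (fun=> 0); split=> [b c|r c|c|L c [] //|p c _]; last by right.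
  - by rewrite addr0.
  - by rewrite scaler0.
  - by rewrite scale0r addr0.
have ioB b c : io (b - c) = io b - io c by rewrite ioD -scaleN1r ioZ scaleN1r.
exists (fun c => (io c.1 + h *: c.2, - io c.2)).
split=> [[u w] [u' w']|r [u w]|[u w]|L [u w] sL [/= eu ew]|p [u w] [/= hu hw]] /=.
- congr (_, _); first by rewrite ioD scalerDr addrACA.
  by rewrite ioD opprD.
- congr (_, _); first by rewrite ioZ scalerDr !scalerA mulrC.
  by rewrite ioZ scalerN.
- congr (_, _).
    rewrite kdD kdZ scalerBr scalerA scalerDl ioE addrC [RHS]addrACA.
    by congr (_ + _); rewrite addrC subrK.
  rewrite kdN opprK ioB ioZ scalerDl ioE scalerDr scalerA [x * h]mulrC opprB.
  by rewrite [RHS]addrC !addrA subrK -[RHS]addrA addrC.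
- have [_ ED EZ] := submodule_entries xs sL.
  split; first by apply: ED; [exact: ioL|exact: EZ].
  by apply: submoduleN; [exact: submodule_entries|exact: ioL].
- split.
    have [_ HD HZ] := submodule_homogeneous xs (p - 1).
    by apply: HD; [exact: ioh|exact: HZ].
  by apply: submoduleN; [exact: submodule_homogeneous|exact: ioh].
Qed.

(** Vanishing of the [p]-th Koszul cohomology of [V / L], expressed on representatives. *)
Definition exact_at xs L p := forall c : koszul xs, homogeneous p c ->
  entries L (kd c) -> exists2 b, homogeneous (p - 1) b & entries L (c - kd b).

Definition add_mult L (f : R) (v : V) := exists u w, L u /\ v = u + f *: w.

Lemma entries_add_mult L xs f p (c : koszul xs) : submodule L ->
  homogeneous p c -> entries (add_mult L f) c ->
  exists b e, [/\ homogeneous p e, entries L b & c = b + f *: e].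
Proof.
move=> sL; elim: xs p c => [p c|x xs IH p [u w] [/= hu hw] [/= eu ew]] /=.
  move=> [->|->] [u [w [Lu E]]]; first by exists u, w; split=> //; left.
  by exists 0, 0; rewrite scaler0 addr0; split=> //; [right|case: sL].
have [b [e [he eb ->]]] := IH _ _ hu eu.
have [b' [e' [he' eb' ->]]] := IH _ _ hw ew.
by exists (b, b'), (e, e').
Qed.

Lemma add_mult_entries L xs f (b c : koszul xs) :
  entries L b -> entries (add_mult L f) (b + f *: c).
Proof.
elim: xs b c => [b c Lb|x xs IH [u w] [u' w'] [/= eu ew]]; first by exists b, c.
by split; apply: IH.
Qed.

Lemma regular_entries L xs f (c : koszul xs) : regular_mod f L ->
  entries L (f *: c) -> entries L c.
Proof.
move=> regf; elim: xs c => [c|x xs IH [u w] [/= eu ew]]; first exact: regf.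
by split; apply: IH.
Qed.

(** * The long exact sequence of multiplication by a regular element *)

Section RegularStep.
Variables (xs : seq R) (L : V -> Prop) (f : R).
Hypotheses (sL : submodule L) (If : in_ideal xs f) (regf : regular_mod f L).

(** In the long exact sequence, the cohomology of [V / (L + f V)] in degree [p] lies between that of
    [V / L] in degrees [p] and [p + 1]. In the chase, [e] represents the image of [c] under the
    connecting map. *)
Lemma exact_at_add_mult p : exact_at xs L p -> exact_at xs L (p + 1) ->
  exact_at xs (add_mult L f) p.
Proof.
move=> exp exp1 c hc ec; have sE := submodule_entries xs sL; have [E0 ED EZ] := sE.
have [b [e [he eb dcE]]] := entries_add_mult sL (homogeneous_kd hc) ec.
have ede : entries L (kd e).
  apply: (regular_entries regf); rewrite -kdZ.
  have -> : f *: e = kd c - b by rewrite dcE addrAC subrr add0r.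
  by rewrite kdB kd_kd sub0r; apply: submoduleN => //; apply: entries_kd.
have [e' he' ee'] := exp1 e he ede; rewrite addrK in he'.
have [||b' hb' eb'] := exp (c - f *: e').
- apply: submoduleB; first exact: submodule_homogeneous.
    by [].
  by have [_ _] := submodule_homogeneous xs p; apply.
- rewrite kdB dcE kdZ -addrA -scalerBr; apply: ED => //; exact: EZ.
- exists b' => //; have -> : c - kd b' = c - f *: e' - kd b' + f *: e'.
    by rewrite addrAC subrK.
  exact: add_mult_entries.
Qed.

(** Since [f] lies in the ideal of [xs], it acts as zero on cohomology, so the connecting map from
    degree [p - 1] of [V / (L + f V)] is onto degree [p] of [V / L]. *)
Lemma exact_at_of_add_mult p : exact_at xs (add_mult L f) (p - 1) ->
  exact_at xs L p.
Proof.
move=> exp c hc ec; have sE := submodule_entries xs sL; have [E0 ED EZ] := sE.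
have [io [ioD ioZ ioE ioL ioh]] := koszul_homotopy If.
have eio : entries L (f *: c - kd (io c)).
  by rewrite ioE addrAC subrr add0r; apply: ioL.
(* The connecting map sends [io c] to [c]: modulo [L], its differential is [f *: c]. *)
have [|b hb] := exp (io c) (ioh _ _ hc).
  have -> : kd (io c) = - (f *: c - kd (io c)) + f *: c by rewrite opprB subrK.
  by apply: add_mult_entries; apply: submoduleN.
have hib : homogeneous (p - 1) (io c - kd b).
  apply: submoduleB; [exact: submodule_homogeneous|exact: ioh|].
  by rewrite -(subrK 1 (p - 1)); apply: homogeneous_kd.
move=> /(entries_add_mult sL hib)[l [u [hu el E]]].
exists u => //; apply: (regular_entries regf).
have -> : f *: (c - kd u) = f *: c - kd (io c) + kd l.
  have -> : kd (io c) = kd l + f *: kd u by rewrite -kdZ -kdD -E kdB kd_kd subr0.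
  by rewrite scalerBr opprD addrA addrAC subrK.
by apply: ED => //; apply: entries_kd.
Qed.
End RegularStep.

Lemma exact_at0_socle xs L v : exact_at xs L 0 ->
  submodule L -> (forall x, x \in xs -> L (x *: v)) -> L v.
Proof.
move=> ex0 sL xsL.
(* The cochain [c] is [v] placed in the coordinate of degree zero. The clause on multiples [r *: c]
   is carried along to make it a cocycle after adding a generator. *)
have [c [hc rc ec Lc]] : exists c : koszul xs, [/\ homogeneous 0 c,
     forall r, L (r *: v) -> entries L (r *: c), entries L (kd c) & entries L c -> L v].
  elim: xs xsL {ex0} => [|x xs IH] xsL.
    by exists v; split=> //=; [left|case: sL].
  have [y yxs|c [hc rc ec Lc]] := IH; first by apply: xsL; rewrite inE yxs orbT.
  have [E0 ED EZ] := submodule_entries xs sL.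
  exists (c, 0); split=> /=.
  - by split=> //; have [] := submodule_homogeneous xs (0 - 1).
  - by move=> r /rc ?; split=> //=; rewrite scaler0.
  - split=> //; rewrite kd0 subr0.
    by apply/rc/xsL/mem_head.
  - by case=> /Lc.
have [b hb] := ex0 c hc ec.
by rewrite (homogeneous_lt0 _ hb) // kd0 subr0 => /Lc.
Qed.
End KoszulComplex.

(** * Regular sequences and Koszul cohomology *)

Section RegularSequences.
Variables (R : comNzRingType) (V : lmodType R).
Implicit Types (fs xs : seq R).

Definition seq_mult fs (v : V) :=
  exists gs : 'I_(size fs) -> V, v = \sum_(j < size fs) nth 0 fs j *: gs j.

(** Regularity without the requirement that the final quotient be nonzero, which [idealmod_proper]
    supplies for graded modules. *)
Definition weak_regular fs :=
  forall i : 'I_(size fs), regular_mod (nth 0 fs i) (seq_mult (take i fs)).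

Lemma submodule_seq_mult fs : submodule (seq_mult fs).
Proof.
split=> [|_ _ [g ->] [h ->]|r _ [g ->]].
- by exists (fun=> 0); rewrite big1 // => j _; rewrite scaler0.
- exists (fun j => g j + h j); rewrite -big_split.
  by apply: eq_bigr => j _; rewrite scalerDr.
- exists (fun j => r *: g j); rewrite scaler_sumr.
  by apply: eq_bigr => j _; rewrite !scalerA mulrC.
Qed.

Lemma seq_mult_nil : seq_mult [::] = (fun v => v = 0).
Proof.
apply/funext => v; apply/propext; split=> [[g ->]|->]; first by rewrite big_ord0.
by exists (fun=> 0); rewrite big_ord0.
Qed.

Lemma seq_mult_rcons fs f : seq_mult (rcons fs f) = add_mult (seq_mult fs) f.
Proof.
apply/funext => v; apply/propext; split.
  rewrite /seq_mult size_rcons => -[g ->]; rewrite big_ord_recr /=.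
  exists (\sum_(j < size fs) nth 0 fs j *: g (widen_ord (leqnSn _) j)), (g ord_max).
  split; first by exists (fun j => g (widen_ord (leqnSn _) j)).
  rewrite nth_rcons ltnn eqxx; congr (_ + _).
  by apply: eq_bigr => j _; rewrite nth_rcons ltn_ord.
move=> [_ [w [[g ->] ->]]]; rewrite /seq_mult size_rcons.
exists (fun j => if insub (val j) is Some j' then g j' else w).
rewrite big_ord_recr /= insubN ?ltnn // nth_rcons ltnn eqxx; congr (_ + _).
apply: eq_bigr => j _; rewrite nth_rcons ltn_ord.
by rewrite insubT //= => ltj; congr (_ *: g _); apply: val_inj.
Qed.

Lemma weak_regular_rcons fs f :
  weak_regular (rcons fs f) <-> weak_regular fs /\ regular_mod f (seq_mult fs).
Proof.
split=> [wreg|[wreg regf] i].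
  split=> [i|].
    have lti : (i < size (rcons fs f))%N by rewrite size_rcons ltnS ltnW.
    by have := wreg (Ordinal lti); rewrite /= nth_rcons ltn_ord -cats1 takel_cat // ltnW.
  have ltf : (size fs < size (rcons fs f))%N by rewrite size_rcons.
  have := wreg (Ordinal ltf); rewrite /= nth_rcons ltnn eqxx.
  by rewrite -cats1 take_size_cat.
case: i => i /=; rewrite {1}size_rcons ltnS leq_eqVlt => /orP[/eqP ->|lti].
  by rewrite nth_rcons ltnn eqxx -cats1 take_size_cat.
rewrite nth_rcons lti -cats1 takel_cat ?(ltnW lti) //.
exact: (wreg (Ordinal lti)).
Qed.

(** Removing the last element of [fs] raises the range of vanishing by one degree. *)
Lemma regular_seq_exact xs fs : {in fs, forall f, in_ideal xs f} -> weak_regular fs ->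
  forall r : nat, (forall p : int, (p < r)%R -> exact_at xs (seq_mult fs) p) ->
  forall p : int, (p < (r + size fs)%N)%R -> exact_at xs (seq_mult [::]) p.
Proof.
elim/last_ind: fs => [_ _ r|fs f IH Ifs]; first by rewrite addn0.
rewrite weak_regular_rcons => -[wreg regf] r exr.
rewrite size_rcons -addSnnS; apply: IH => // [g gfs|p ltp].
  by apply: Ifs; rewrite mem_rcons inE gfs orbT.
apply: (exact_at_of_add_mult (f := f)) => //; first exact: submodule_seq_mult.
  by apply: Ifs; rewrite mem_rcons mem_head.
by rewrite -seq_mult_rcons; apply: exr; lia.
Qed.

(** Vanishing in degree zero means that there is no socle, so a regular element exists; appending it
    to [fs] costs one degree of vanishing. *)
Lemma exact_regular_seq xs : noetherian V -> forall (r : nat) fs,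
  {in fs, forall f, in_ideal xs f} -> weak_regular fs ->
  (forall p : int, (p < r)%R -> exact_at xs (seq_mult fs) p) ->
  exists fs', [/\ size fs' = (r + size fs)%N, {in fs', forall f, in_ideal xs f}
                & weak_regular fs'].
Proof.
move=> noeV; elim=> [|r IH] fs Ifs wreg exr; first by exists fs.
have sfs := submodule_seq_mult fs.
have [v xsv|f If regf] := exists_regular (xs := xs) noeV sfs.
  by apply: (exact_at0_socle (xs := xs)) => //; apply: exr.
have [||p ltp|fs' [szfs' Ifs' wreg']] := IH (rcons fs f).
- by move=> g; rewrite mem_rcons inE => /orP[/eqP->|/Ifs].
- exact/weak_regular_rcons.
- by rewrite seq_mult_rcons; apply: exact_at_add_mult => //; apply: exr; lia.
- by exists fs'; split=> //; rewrite szfs' size_rcons addnS.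
Qed.

Lemma regular_seq_koszul xs (r : nat) : noetherian V ->
  (exists fs, [/\ size fs = r, {in fs, forall f, in_ideal xs f} & weak_regular fs])
  <-> forall p : int, (p < r)%R -> @exact_at R V xs (fun v => v = 0) p.
Proof.
move=> noeV; split=> [[fs [szfs Ifs wreg]] p ltp|exr].
  rewrite -seq_mult_nil; apply: (regular_seq_exact (r := 0) Ifs wreg); last first.
    by rewrite szfs.
  move=> q ltq c hc _; exists 0; first by have [] := @submodule_homogeneous R V xs (q - 1).
  rewrite (homogeneous_lt0 ltq hc) kd0 subr0.
  by have [] := submodule_entries xs (submodule_seq_mult fs).
have [||p ltp|fs [szfs Ifs wreg]] := exact_regular_seq (xs := xs) (r := r) (fs := [::]) noeV.
- by [].
- by case.
- by rewrite seq_mult_nil; apply: exr.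
- by exists fs; rewrite szfs addn0.
Qed.
End RegularSequences.

(** * Maps of Koszul complexes and retracts of cones *)

Section KoszulMap.
Variables (R : comNzRingType) (V W : lmodType R) (f : V -> W).
Implicit Types (xs : seq R).

Fixpoint koszul_map xs : koszul V xs -> koszul W xs :=
  match xs with
  | [::] => f
  | _ :: xs' => fun c => (koszul_map c.1, koszul_map c.2)
  end.

Hypothesis fD : {morph f : u v / u + v}.

Lemma koszul_mapD xs : {morph @koszul_map xs : b c / b + c}.
Proof. by elim: xs => // x xs IH [u w] [u' w']; rewrite /= !IH. Qed.

Lemma koszul_map0 xs : @koszul_map xs 0 = 0.
Proof. by apply: (addIr (koszul_map 0)); rewrite -koszul_mapD !add0r. Qed.

Lemma koszul_mapB xs : {morph @koszul_map xs : b c / b - c}.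
Proof.
by move=> b c; apply: (addIr (koszul_map c)); rewrite -koszul_mapD !subrK.
Qed.

Lemma homogeneous_koszul_map xs p (c : koszul V xs) :
  homogeneous p c -> homogeneous p (koszul_map c).
Proof.
elim: xs p c => [p c [->|->]|x xs IH p [u w] [/= hu hw]]; first by left.
  by right; exact: (@koszul_map0 [::]).
by split; apply: IH.
Qed.

Lemma koszul_mapZ xs x (c : koszul V xs) : {morph f : v / x *: v} ->
  koszul_map (x *: c) = x *: koszul_map c.
Proof. by move=> fx; elim: xs c => //= y xs IH [u w]; rewrite !IH. Qed.

Lemma koszul_map_kd xs (c : koszul V xs) :
  {in xs, forall x, {morph f : v / x *: v}} ->
  koszul_map (kd c) = kd (koszul_map c).
Proof.
elim: xs c => [c _|x xs IH [u w] fx] /=; first exact: (@koszul_map0 [::]).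
have fxs : {in xs, forall y, {morph f : v / y *: v}}.
  by move=> y yxs; apply: fx; rewrite inE yxs orbT.
by rewrite koszul_mapB koszul_mapZ ?IH //; apply/fx/mem_head.
Qed.
End KoszulMap.

Lemma entries_eq0 (R : comNzRingType) (V : lmodType R) xs (c : koszul V xs) :
  entries (fun v => v = 0) c <-> c = 0.
Proof.
elim: xs c => // x xs IH [u w] /=.
by rewrite !IH; split=> [[-> ->]|[-> ->]].
Qed.

(* [a] and [b] embed the complex [x : V -> V] as a direct summand of
   [x : W -> W]; [rho] contracts the complementary summand. *)
Section ConeRetract.
Variables (R : comNzRingType) (V W : lmodType R) (x : R) (xs : seq R).
Variables (a b : V -> W) (a' b' : W -> V) (rho : W -> W).
Hypotheses (aD : {morph a : u v / u + v}) (bD : {morph b : u v / u + v})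
  (a'D : {morph a' : u v / u + v}) (b'D : {morph b' : u v / u + v})
  (rhoD : {morph rho : u v / u + v}).
Hypotheses (aX : {in xs, forall y, {morph a : v / y *: v}})
  (bX : {in xs, forall y, {morph b : v / y *: v}})
  (a'X : {in xs, forall y, {morph a' : v / y *: v}})
  (b'X : {in xs, forall y, {morph b' : v / y *: v}})
  (rhoX : {in xs, forall y, {morph rho : v / y *: v}}).
Hypotheses (aK : cancel a a') (bK : cancel b b')
  (xa : forall v, x *: a v = b (x *: v)) (xa' : forall w, x *: a' w = b' (x *: w))
  (aa' : forall w, a (a' w) + rho (x *: w) = w)
  (bb' : forall w, b (b' w) + x *: rho w = w).

Lemma exact_at_cone_retract p :
  exact_at (x :: xs) (fun v : V => v = 0) p <->
  exact_at (x :: xs) (fun w : W => w = 0) p.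
Proof.
pose A := koszul_map a (xs := xs); pose B := koszul_map b (xs := xs).
pose A' := koszul_map a' (xs := xs); pose B' := koszul_map b' (xs := xs).
pose C := koszul_map rho (xs := xs).
have AK u : A' (A u) = u by rewrite /A /A'; elim: xs u => //= y ys IH [u w]; rewrite !IH.
have BK u : B' (B u) = u by rewrite /B /B'; elim: xs u => //= y ys IH [u w]; rewrite !IH.
have XA u : x *: A u = B (x *: u).
  by rewrite /A /B; elim: xs u => //= y ys IH [u w]; rewrite -!IH.
have XA' u : x *: A' u = B' (x *: u).
  by rewrite /A' /B'; elim: xs u => //= y ys IH [u w]; rewrite -!IH.
have AA' u : A (A' u) + C (x *: u) = u.
  rewrite /A' /A /C; elim: xs u => //= y ys IH [u w].
  by rewrite -[RHS](congr2 pair (IH u) (IH w)).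
have BB' u : B (B' u) + x *: C u = u.
  rewrite /B' /B /C; elim: xs u => //= y ys IH [u w].
  by rewrite -[RHS](congr2 pair (IH u) (IH w)).
split=> ex [u w] [/= hu hw] [/entries_eq0 du /entries_eq0/eqP].
- rewrite subr_eq0 => /eqP xu.
  have [||[b1 b2] [/= h1 h2] [/entries_eq0 E1 /entries_eq0 E2]] := ex (A' u, B' w).
  + by split; apply: homogeneous_koszul_map.
  + split; apply/entries_eq0; rewrite /= -!koszul_map_kd //.
      by rewrite du koszul_map0.
    by rewrite XA' xu subrr.
  (* [A b1] accounts only for the summand coming from [V]. Since [kd w = x *: u], the term [C w] has
     differential [C (x *: u)], the missing part of [u]. *)
  exists (A b1 + C w, B b2).
    split=> /=; last exact: homogeneous_koszul_map.
    have [_ HD _] := @submodule_homogeneous R W xs (p - 1).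
    by apply: HD; apply: homogeneous_koszul_map.
  have {}E1 := subr0_eq E1; have {}E2 := subr0_eq E2; rewrite /= in E1 E2.
  split; apply/entries_eq0 => /=.
    by rewrite kdD -!koszul_map_kd // -E1 -xu AA' subrr.
  rewrite scalerDr XA -koszul_map_kd // addrAC -koszul_mapB // -E2 BB'.
  by rewrite subrr.
- rewrite subr_eq0 => /eqP xu.
  have [||[b1 b2] [/= h1 h2] [/entries_eq0 E1 /entries_eq0 E2]] := ex (A u, B w).
  + by split; apply: homogeneous_koszul_map.
  + split; apply/entries_eq0; rewrite /= -!koszul_map_kd //.
      by rewrite du koszul_map0.
    by rewrite XA xu subrr.
  have {}E1 := subr0_eq E1; have {}E2 := subr0_eq E2; rewrite /= in E1 E2.
  exists (A' b1, B' b2); first by split; apply: homogeneous_koszul_map.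
  split; apply/entries_eq0; rewrite /= -!koszul_map_kd //.
    by rewrite -E1 [koszul_map a' _]AK subrr.
  by rewrite XA' -koszul_mapB // -E2 [koszul_map b' _]BK subrr.
Qed.
End ConeRetract.

(** * Noetherianity *)

Section HilbertBasis.
Variables (K : fieldType) (n : nat) (V : lmodType {mpoly K[n]}).
Implicit Types (k : nat) (N : V -> Prop) (G : seq V).

(** These are the submodules over the polynomial ring in the first [k] variables. Keeping [V] fixed
    lets the induction on [k] proceed without changing rings. *)
Record stable_upto k N : Prop := StableUpto {
  stable0 : N 0;
  stableD : forall u v, N u -> N v -> N (u + v);
  stableZ : forall c v, N v -> N (c%:MP *: v);
  stableX : forall (i : 'I_n) v, (i < k)%N -> N v -> N ('X_i *: v) }.

Lemma stableN k N : stable_upto k N -> forall v, N v -> N (- v).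
Proof. by move=> sN v /(stableZ sN (-1)); rewrite mpolyCN scaleN1r. Qed.

Lemma stableB k N : stable_upto k N -> forall u v, N u -> N v -> N (u - v).
Proof. by move=> sN u v Nu /(stableN sN); apply: stableD sN _ _ Nu. Qed.

Lemma stable_uptoI k N N' :
  stable_upto k N -> stable_upto k N' -> stable_upto k (fun v => N v /\ N' v).
Proof.
move=> [N0 ND NZ NX] [N0' ND' NZ' NX']; split=> //.
- by move=> u v [? ?] [? ?]; split; [apply: ND|apply: ND'].
- by move=> c v [? ?]; split; [apply: NZ|apply: NZ'].
- by move=> i v ik [? ?]; split; [apply: NX|apply: NX'].
Qed.

Inductive span_upto G k : V -> Prop :=
| Span_mem g : g \in G -> span_upto G k g
| Span_0 : span_upto G k 0
| Span_D u v : span_upto G k u -> span_upto G k v -> span_upto G k (u + v)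
| Span_Z c v : span_upto G k v -> span_upto G k (c%:MP *: v)
| Span_X (i : 'I_n) v : (i < k)%N -> span_upto G k v -> span_upto G k ('X_i *: v).

Lemma stable_span_upto G k : stable_upto k (span_upto G k).
Proof. by split; [apply: Span_0|apply: Span_D|apply: Span_Z|apply: Span_X]. Qed.

Lemma chain_leq (L : nat -> V -> Prop) : (forall s v, L s v -> L s.+1 v) ->
  forall s s' v, (s <= s')%N -> L s v -> L s' v.
Proof.
move=> LS s s' v /subnK <- Lv; elim: (s' - s)%N => // e IH.
by rewrite addSn; apply: LS.
Qed.

Definition noetherian_upto k N := forall L : nat -> V -> Prop,
  (forall s, stable_upto k (L s)) -> (forall s v, L s v -> N v) ->
  (forall s v, L s v -> L s.+1 v) -> exists s0, forall s v, L s v -> L s0 v.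

Lemma span_upto0_nil v : span_upto [::] 0 v -> v = 0.
Proof. by elim=> // [u {}v _ -> _ ->|c {}v _ ->]; rewrite ?addr0 ?scaler0. Qed.

Lemma span_upto0_cons g G v : span_upto (g :: G) 0 v ->
  exists c u, span_upto G 0 u /\ v = c%:MP *: g + u.
Proof.
elim=> [h||u {}v _ [c [u' [Gu ->]]] _ [d [v' [Gv ->]]]|d {}v _ [c [u [Gu ->]]]|//].
- rewrite inE => /orP[/eqP->|Gh].
    by exists 1, 0; rewrite addr0 scale1r; split=> //; apply: Span_0.
  by exists 0, h; rewrite mpolyC0 scale0r add0r; split=> //; apply: Span_mem.
- by exists 0, 0; rewrite mpolyC0 scale0r addr0; split=> //; apply: Span_0.
- exists (c + d), (u' + v'); rewrite mpolyCD scalerDl addrACA.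
  by split=> //; apply: Span_D.
- exists (d * c), (d%:MP *: u); rewrite mpolyCM scalerDr scalerA.
  by split=> //; apply: Span_Z.
Qed.

Lemma noetherian_span_upto0 G : noetherian_upto 0 (span_upto G 0).
Proof.
elim: G => [|g G IH] L sL LG LS.
  by exists 0%N => s v /LG/span_upto0_nil->; apply: stable0 (sL _).
have [||s v [/LS ? ?] //|s0 s0P] := IH (fun s v => L s v /\ span_upto G 0 v).
- by move=> s; apply: stable_uptoI => //; apply: stable_span_upto.
- by move=> s v [].
(* Either some element of the chain involves [g], and its multiples clear the coefficient of [g] in
   all others, or the whole chain lies in the span of [G]. *)
case: (pselect (exists s c u, [/\ c != 0, span_upto G 0 u & L s (c%:MP *: g + u)])).
  move=> [s1 [c [u [c0 Gu Lu]]]]; exists (maxn s0 s1) => s v Lv.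
  have [d [w [Gw vE]]] := span_upto0_cons (LG _ _ Lv).
  pose z := (d / c)%:MP *: (c%:MP *: g + u).
  have Lz m : (s1 <= m)%N -> L m z.
    by move=> lem; apply: stableZ (sL _) _ _ _; apply: chain_leq lem Lu.
  have zE : v - z = w - (d / c)%:MP *: u.
    by rewrite /z scalerDr scalerA -mpolyCM divfK // vE opprD addrACA subrr add0r.
  rewrite -(subrK z v); apply: stableD (sL _) _ _ _ _; last by apply: Lz; rewrite leq_maxr.
  apply: (chain_leq LS (leq_maxl s0 s1)).
  have [] // := s0P (maxn s s1) (v - z); split.
    apply: stableB (sL _) _ _ _ _; first by apply: chain_leq LS _ _ _ (leq_maxl _ _) Lv.
    by apply: Lz; rewrite leq_maxr.
  rewrite zE; apply: stableB (stable_span_upto G 0) _ _ Gw _.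
  exact: Span_Z.
move=> nex; exists s0 => s v Lv.
have [d [w [Gw vE]]] := span_upto0_cons (LG _ _ Lv).
have d0 : d = 0.
  apply/eqP; apply: contrapT => /negP d0; apply: nex.
  by exists s, d, w; split=> //; rewrite -vE.
have [] // := s0P s v; split=> //.
by rewrite vE d0 mpolyC0 scale0r add0r.
Qed.

(** * Hilbert's basis theorem: adjoining one variable *)

Section HilbertStep.
Variables (G : seq V) (i0 : 'I_n).
Local Notation k := (i0 : nat).
Local Notation x := ('X_i0 : {mpoly K[n]}).

Lemma span_uptoS v : span_upto G k.+1 v -> exists T (u : nat -> V),
  (forall t, span_upto G k (u t)) /\ v = \sum_(t < T) x ^+ t *: u t.
Proof.
elim=> {v} [g Gg||u v _ [T [u' [Gu ->]]] _ [S [v' [Gv ->]]]|c v _ [T [u [Gu ->]]]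
  |i v].
- exists 1%N, (fun=> g); split; first by move=> _; apply: Span_mem.
  by rewrite big_ord1 expr0 scale1r.
- by exists 0%N, (fun=> 0); split; [move=> _; apply: Span_0|rewrite big_ord0].
- exists (maxn T S), (fun t => (if (t < T)%N then u' t else 0)
                             + (if (t < S)%N then v' t else 0)).
  split=> [t|]; first by apply: Span_D; case: ifP => // _; apply: Span_0.
  rewrite (big_ord_widen _ (fun t => x ^+ t *: u' t) (leq_maxl T S)).
  rewrite (big_ord_widen _ (fun t => x ^+ t *: v' t) (leq_maxr T S)).
  rewrite big_mkcond [X in _ + X]big_mkcond -big_split; apply: eq_bigr => t _ /=.
  by rewrite scalerDr; congr (_ + _); case: ifP; rewrite ?scaler0.
- exists T, (fun t => c%:MP *: u t); split; first by move=> t; apply: Span_Z.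
  rewrite scaler_sumr; apply: eq_bigr => t _.
  by rewrite !scalerA mulrC.
- rewrite ltnS leq_eqVlt => /orP[/eqP/val_inj->|ik] _ [T [u [Gu ->]]].
    exists T.+1, (fun t => if t is t'.+1 then u t' else 0); split.
      by case=> [|t] //; apply: Span_0.
    rewrite big_ord_recl scaler0 add0r scaler_sumr.
    by apply: eq_bigr => t _; rewrite scalerA -exprS.
  exists T, (fun t => 'X_i *: u t); split; first by move=> t; apply: Span_X.
  rewrite scaler_sumr; apply: eq_bigr => t _.
  by rewrite !scalerA mulrC.
Qed.

(** Expansions in powers of [x] need not be unique in [V], so the leading coefficients of all
    expansions of elements of [L] are collected. *)
Definition lead_coefs (L : V -> Prop) t w := span_upto G k w /\
  exists u : nat -> V, (forall t', span_upto G k (u t')) /\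
    L (x ^+ t *: w + \sum_(t' < t) x ^+ t' *: u t').

Lemma stable_lead_coefs L t : stable_upto k.+1 L -> stable_upto k (lead_coefs L t).
Proof.
move=> sL; split=> [|v w [Gv [u [Gu Lu]]] [Gw [u' [Gu' Lu']]]|c w [Gw [u [Gu Lu]]]
                   |i w ik [Gw [u [Gu Lu]]]].
- split; first exact: Span_0.
  exists (fun=> 0); split; first by move=> _; apply: Span_0.
  rewrite scaler0 big1 ?addr0; first exact: stable0 sL.
  by move=> j _; rewrite scaler0.
- split; first exact: Span_D.
  exists (fun t => u t + u' t); split; first by move=> s; apply: Span_D.
  have := stableD sL Lu Lu'; rewrite addrACA -big_split -scalerDr /=.
  by under eq_bigr do rewrite -scalerDr.
- split; first exact: Span_Z.
  exists (fun t => c%:MP *: u t); split; first by move=> s; apply: Span_Z.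
  have := stableZ sL c Lu; rewrite scalerDr scaler_sumr scalerA mulrC -scalerA.
  by under eq_bigr do rewrite scalerA mulrC -scalerA.
- split; first exact: Span_X.
  exists (fun t => 'X_i *: u t); split; first by move=> s; apply: Span_X.
  have := stableX sL (leqW ik) Lu; rewrite scalerDr scaler_sumr scalerA mulrC -scalerA.
  by under eq_bigr do rewrite scalerA mulrC -scalerA.
Qed.

Lemma lead_coefsS L t w : stable_upto k.+1 L -> lead_coefs L t w -> lead_coefs L t.+1 w.
Proof.
move=> sL [Gw [u [Gu Lu]]]; split=> //.
exists (fun t => if t is t'.+1 then u t' else 0); split.
  by case=> [|s] //; apply: Span_0.
have := stableX sL (ltnSn k) Lu; rewrite scalerDr scalerA -exprS scaler_sumr.
rewrite big_ord_recl scaler0 add0r.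
by under eq_bigr do rewrite scalerA -exprS.
Qed.

Lemma lead_coefs_leq L s t w : stable_upto k.+1 L -> (s <= t)%N ->
  lead_coefs L s w -> lead_coefs L t w.
Proof.
move=> sL; apply: (chain_leq (L := fun t => lead_coefs L t)) => {}t {}w.
exact: lead_coefsS.
Qed.

Lemma lead_coefs_sub (L L' : V -> Prop) t w : (forall v, L v -> L' v) ->
  lead_coefs L t w -> lead_coefs L' t w.
Proof. by move=> LL [Gw [u [Gu /LL Lu]]]; split=> //; exists u. Qed.

Lemma noetherian_span_uptoS :
  noetherian_upto k (span_upto G k) -> noetherian_upto k.+1 (span_upto G k.+1).
Proof.
move=> noeN L sL LG LS.
have Lle s s' v : (s <= s')%N -> L s v -> L s' v by exact: chain_leq.
have [||s w|d dP] := noeN (fun s => lead_coefs (L s) s).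
- by move=> s; apply: stable_lead_coefs.
- by move=> s w [].
- by move=> /(lead_coefsS (sL s)); apply/lead_coefs_sub/LS.
have /choice[c cP] t : exists s0, forall s w, lead_coefs (L s) t w -> lead_coefs (L s0) t w.
  apply: (noeN (fun s => lead_coefs (L s) t)).
  - by move=> s; apply: stable_lead_coefs.
  - by move=> s w [].
  - by move=> s w; apply/lead_coefs_sub/LS.
(* The diagonal chain settles all degrees [t >= d] at stage [d]; each of the finitely many smaller
   degrees [t] is settled at stage [c t]. *)
pose m := maxn d (\max_(t < d) c t).
have leadP s t w : lead_coefs (L s) t w -> lead_coefs (L m) t w.
  have [ltd|led] := ltnP t d => Lw.
    apply: lead_coefs_sub (cP t s w Lw) => v; apply: Lle.
    rewrite /m leq_max orbC.
    by rewrite (leq_bigmax (F := fun t : 'I_d => c t) (Ordinal ltd)).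
  apply: (lead_coefs_sub (L := L d)) => [v|].
    by apply: Lle; rewrite leq_maxl.
  apply: (lead_coefs_leq (sL d) led); apply: (dP (maxn s t)).
  apply: (lead_coefs_leq (sL _) (leq_maxr s t)).
  by apply: lead_coefs_sub Lw => v; apply: Lle; rewrite leq_maxl.
exists m => s v Lv.
(* Moving to a stage beyond [m] allows elements of [L m] to be subtracted within [L s]. *)
have {Lv} : L (maxn s m) v by apply: Lle Lv; rewrite leq_maxl.
have lem : (m <= maxn s m)%N by rewrite leq_maxr.
move: (maxn s m) lem => {}s lem Lv.
have [T [u [Gu vE]]] := span_uptoS (LG _ _ Lv); move: Lv; rewrite {}vE {v}.
elim: T u Gu => [|T IH] u Gu; first by rewrite big_ord0 => _; apply: stable0 (sL _).
rewrite big_ord_recr /= addrC => Lv.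
have [|_ [u' [Gu' Lu']]] := leadP s T (u T); first by split=> //; exists u.
(* Subtracting an element of [L m] with the same leading term leaves an expansion with fewer
   terms. *)
rewrite -[X in L m X](subrK (x ^+ T *: u T + \sum_(t < T) x ^+ t *: u' t)).
apply: (stableD (sL m) _ Lu').
have -> : x ^+ T *: u T + \sum_(t < T) x ^+ t *: u t
    - (x ^+ T *: u T + \sum_(t < T) x ^+ t *: u' t)
  = \sum_(t < T) x ^+ t *: (u t - u' t).
  rewrite opprD addrACA subrr add0r -sumrB.
  by apply: eq_bigr => t _; rewrite scalerBr.
apply: (IH (fun t => u t - u' t)) => [t|].
  by apply: stableB (stable_span_upto G k) _ _ _ _.
have := stableB (sL s) Lv (Lle _ _ _ lem Lu').
rewrite opprD addrACA subrr add0r -sumrB.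
by under eq_bigr do rewrite -scalerBr.
Qed.
End HilbertStep.

Lemma noetherian_span_upto G k : (k <= n)%N -> noetherian_upto k (span_upto G k).
Proof.
elim: k => [_|k IH ltk]; first exact: noetherian_span_upto0.
exact: (noetherian_span_uptoS (i0 := Ordinal ltk)) (IH (ltnW ltk)).
Qed.

Lemma noetherian_of_span G : (forall v, span_upto G n v) -> noetherian V.
Proof.
move=> Gv L sL LS.
have [s|s v _|//|s sP] := noetherian_span_upto (leqnn n) (G := G) (L := L).
- by have [L0 LD LZ] := sL s; split=> // [c v|i v _]; exact: LZ.
- exact: Gv.
- by exists s => v; apply: sP.
Qed.
End HilbertBasis.

(** * The total module of a graded module *)

Section EvalMonomials.
Variables (K : fieldType) (n : nat) (W : lmodType K).
Implicit Types (h : 'X_{1..n} -> W) (p q : {mpoly K[n]}).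

(** The linear extension of [h] from monomials to polynomials; in each degree [polyact] has this
    form, which reduces the module axioms to monomials. *)
Definition eval_mon h p : W := \sum_(b <- msupp p) p@_b *: h b.

Lemma eval_mon_sub h p (r : seq 'X_{1..n}) : uniq r -> {subset msupp p <= r} ->
  eval_mon h p = \sum_(b <- r) p@_b *: h b.
Proof.
move=> ur sub; rewrite (bigID (mem (msupp p))) /= [X in _ + X]big1 ?addr0.
  rewrite -big_filter; apply/perm_big/uniq_perm; rewrite ?filter_uniq //.
  by move=> b; rewrite mem_filter /= andbC; case: (boolP (b \in msupp p)) => [/sub->|];
     rewrite ?andbF.
by move=> b /memN_msupp_eq0->; rewrite scale0r.
Qed.

Lemma eval_monD h : {morph eval_mon h : p q / p + q}.
Proof.
move=> p q; pose r := undup (msupp p ++ msupp q ++ msupp (p + q)).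
have ur : uniq r by apply: undup_uniq.
rewrite !(eval_mon_sub h ur) => [|b|b|b]; rewrite ?mem_undup ?mem_cat;
  try by move->; rewrite ?orbT.
by rewrite -big_split; apply: eq_bigr => b _; rewrite mcoeffD scalerDl.
Qed.

Lemma eval_monZX h c m : eval_mon h (c *: 'X_[m]) = c *: h m.
Proof.
rewrite (@eval_mon_sub h _ [:: m]) //; last by move=> b /msuppZ_le; rewrite msuppX.
by rewrite big_seq1 mcoeffZ mcoeffX eqxx mulr1.
Qed.

Lemma eval_mon0 h : eval_mon h 0 = 0.
Proof. by rewrite /eval_mon msupp0 big_nil. Qed.

Lemma eval_monM h p q :
  eval_mon h (p * q) = eval_mon (fun b => eval_mon (fun c => h (b + c)%MM) q) p.
Proof.
rewrite mpolyME (big_morph _ (eval_monD h) (eval_mon0 h)) big_allpairs.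
apply: eq_bigr => b _; rewrite /= scaler_sumr.
by apply: eq_bigr => c _; rewrite eval_monZX scalerA.
Qed.
End EvalMonomials.

HB.instance Definition _ n := gen_eqMixin (deg n).
HB.instance Definition _ n := gen_choiceMixin (deg n).

Lemma finsuppP (K : fieldType) n (M : grmod K n) (v : forall a, M a) :
  finsupp v <-> exists s : seq (deg n), forall a, v a != 0 -> a \in s.
Proof.
by split=> -[s sP]; exists s => a /sP;
  [case/hasP=> b bs /forallP E; have -> : a = b by apply/funext => k; apply/esym/eqP|
   move=> as_; apply/hasP; exists a => //; apply/forallP].
Qed.

Section TotalModule.
Variables (K : fieldType) (n : nat) (M : grmod K n).
Implicit Types (a : deg n).

Lemma gmul0 a (c : deg n) : gmul M a c 0 = 0.
Proof. by rewrite -(scale0r 0) gmulZ scale0r. Qed.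

Lemma gmul_sum a (c : deg n) I (r : seq I) (P : pred I) (F : I -> M a) :
  gmul M a c (\sum_(x <- r | P x) F x) = \sum_(x <- r | P x) gmul M a c (F x).
Proof. exact: (big_morph _ (@gmulD K n M a c) (gmul0 a c)). Qed.

Definition fam := forall a, M a.

Lemma famP (u v : fam) : (forall a, u a = v a) -> u = v.
Proof. exact: functional_extensionality_dep. Qed.

HB.instance Definition _ := gen_eqMixin fam.
HB.instance Definition _ := gen_choiceMixin fam.

Fact fam_addA : associative (fun u v : fam => (fun a => u a + v a) : fam).
Proof. by move=> u v w; apply: famP => a; rewrite addrA. Qed.
Fact fam_addC : commutative (fun u v : fam => (fun a => u a + v a) : fam).
Proof. by move=> u v; apply: famP => a; rewrite addrC. Qed.
Fact fam_add0 : left_id ((fun=> 0) : fam) (fun u v : fam => (fun a => u a + v a) : fam).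
Proof. by move=> u; apply: famP => a; rewrite add0r. Qed.
Fact fam_addN : left_inverse ((fun=> 0) : fam) (fun u : fam => (fun a => - u a) : fam)
  (fun u v : fam => (fun a => u a + v a) : fam).
Proof. by move=> u; apply: famP => a; rewrite addNr. Qed.

HB.instance Definition _ := GRing.isZmodule.Build fam fam_addA fam_addC fam_add0 fam_addN.

Definition adddeg (a : deg n) (b : 'X_{1..n}) : deg n := fun k => a k + (b k)%:Z.

Lemma subdeg0 a : subdeg a 0%MM = a.
Proof. by apply/funext => k; rewrite /subdeg mnm0E subr0. Qed.

Lemma subdegD a b c : subdeg a (b + c)%MM = subdeg (subdeg a b) c.
Proof. by apply/funext => k; rewrite /subdeg mnmDE; lia. Qed.

Lemma dle_subdeg a b : dle (subdeg a b) a.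
Proof. by apply/forallP => k; rewrite /subdeg; lia. Qed.

Lemma dle_refl a : dle a a.
Proof. by apply/forallP => k. Qed.

Definition mon_shift (b : 'X_{1..n}) (v : fam) (a : deg n) : M a :=
  gmul M (subdeg a b) a (v (subdeg a b)).

Lemma polyactE f (v : fam) a : polyact f v a = eval_mon (fun b => mon_shift b v a) f.
Proof. by []. Qed.

Lemma mon_shift0 v a : mon_shift 0 v a = v a.
Proof. by rewrite /mon_shift subdeg0 gmul_id. Qed.

Lemma mon_shiftD b c v a :
  mon_shift b (fun a' => mon_shift c v a') a = mon_shift (b + c)%MM v a.
Proof. by rewrite /mon_shift gmul_comp ?dle_subdeg // -subdegD. Qed.

Fact fam_scalerA f g (v : fam) :
  (polyact f (polyact g v : fam) : fam) = polyact (f * g) v.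
Proof.
apply: famP => a; rewrite !polyactE eval_monM.
apply: eq_bigr => b _; congr (_ *: _).
rewrite {1}/mon_shift polyactE /eval_mon gmul_sum.
by apply: eq_bigr => c _; rewrite gmulZ /= -mon_shiftD.
Qed.

Fact fam_scale1r (v : fam) : (polyact 1 v : fam) = v.
Proof.
apply: famP => a; rewrite polyactE -mpolyX0 -[X in eval_mon _ X]scale1r eval_monZX.
by rewrite scale1r mon_shift0.
Qed.

Fact fam_scalerDr f (u v : fam) :
  (polyact f (u + v) : fam) = (polyact f u : fam) + (polyact f v : fam).
Proof.
apply: famP => a; rewrite /polyact -[RHS]big_split; apply: eq_bigr => b _ /=.
by rewrite -scalerDr -gmulD.
Qed.

Fact fam_scalerDl (v : fam) f g :
  (polyact (f + g) v : fam) = (polyact f v : fam) + (polyact g v : fam).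
Proof. by apply: famP => a; rewrite polyactE eval_monD. Qed.

HB.instance Definition _ := GRing.Zmodule_isLmodule.Build {mpoly K[n]} fam
  fam_scalerA fam_scale1r fam_scalerDr fam_scalerDl.

Lemma polyact_support f (v : fam) a : polyact f v a != 0 ->
  exists2 b, b \in msupp f & v (subdeg a b) != 0.
Proof.
move=> nz; apply: contrapT => nb; move/eqP: nz; apply.
rewrite /polyact big_seq big1 // => b bf.
have -> : v (subdeg a b) = 0 by apply/eqP/negP => nv; apply: nb; exists b => //; apply/negP.
by rewrite gmul0 scaler0.
Qed.

Definition finsuppb : {pred fam} := fun v => `[< finsupp v >].

Fact finsuppb_submod : submod_closed finsuppb.
Proof.
split=> [|f u v /asboolP/finsuppP[s us] /asboolP/finsuppP[r vr]].
  by apply/asboolP/finsuppP; exists [::] => a; rewrite eqxx.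
apply/asboolP/finsuppP.
exists ([seq adddeg a b | a <- s, b <- msupp f] ++ r) => a.
rewrite mem_cat => nz; case: (boolP (a \in r)) => [_|nr]; first by rewrite orbT.
have v0 : v a = 0 by apply/eqP; apply: contraNT nr => /vr.
have [|b bf unz] := @polyact_support f u a.
  by apply: contraNN nz => /eqP fu0; rewrite -[X in X == _]/(polyact f u a + v a) fu0 v0 addr0.
rewrite orbF; apply/allpairsP; exists (subdeg a b, b); split=> //=; first exact: us.
by apply/funext => k; rewrite /adddeg /subdeg subrK.
Qed.

HB.instance Definition _ := GRing.isSubmodClosed.Build _ _ finsuppb finsuppb_submod.

Record tot := Tot { tot_fam : fam; tot_supp : finsuppb tot_fam }.
Definition tot_fun (v : tot) : forall a, M a := tot_fam v.
Coercion tot_fun : tot >-> Funclass.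

HB.instance Definition _ := [isSub for tot_fam].
HB.instance Definition _ := [Choice of tot by <:].
HB.instance Definition _ := [SubChoice_isSubLmodule of tot by <:].

Lemma totP (u v : tot) : (forall a, u a = v a) -> u = v.
Proof. by move=> E; apply/val_inj/famP. Qed.

Lemma tot_finsupp (v : tot) : finsupp v.
Proof. exact/asboolP/tot_supp. Qed.

Lemma totD (u v : tot) a : (u + v) a = u a + v a.
Proof. by []. Qed.

Lemma totZ f (v : tot) a : (f *: v) a = polyact f v a.
Proof. by []. Qed.

Lemma totX b (v : tot) a : ('X_[b] *: v) a = mon_shift b v a.
Proof. by rewrite totZ polyactE -[X in eval_mon _ X]scale1r eval_monZX scale1r. Qed.

Lemma totC c (v : tot) a : (c%:MP *: v) a = c *: v a.
Proof.
have -> : c%:MP = c *: 'X_[0] :> {mpoly K[n]} by rewrite -mul_mpolyC mpolyX0 mulr1.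
by rewrite totZ polyactE eval_monZX mon_shift0.
Qed.

Lemma tot0 a : (0 : tot) a = 0.
Proof. by []. Qed.

Lemma tot_sum I (r : seq I) (P : pred I) (F : I -> tot) a :
  (\sum_(x <- r | P x) F x) a = \sum_(x <- r | P x) F x a.
Proof. exact: (big_morph (fun v : tot => v a) (fun u v => totD u v a) (tot0 a)). Qed.

(** Multiplication between equal degrees is the identity, so [gmul] serves as the transport from
    [M a] to [M c] without a dependent cast. *)
Definition homel_fam a (u : M a) : fam := fun c => if `[< a = c >] then gmul M a c u else 0.

Fact homel_fam_supp a (u : M a) : finsuppb (homel_fam u).
Proof.
apply/asboolP/finsuppP; exists [:: a] => c; rewrite inE /homel_fam.
by case: asboolP => [E _|_]; [apply/eqP|rewrite eqxx].
Qed.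

Definition homel a (u : M a) : tot := Tot (homel_fam_supp u).

Lemma homelE a (u : M a) : homel u a = u.
Proof. by rewrite /homel /tot_fun /= /homel_fam asboolT ?gmul_id. Qed.

Lemma homelD a (u v : M a) : homel (u + v) = homel u + homel v.
Proof.
apply: totP => c; rewrite totD /tot_fun /= /homel_fam.
by case: ifP; rewrite ?gmulD ?addr0.
Qed.

Lemma homelZ a k (u : M a) : homel (k *: u) = k%:MP *: homel u.
Proof.
apply: totP => c; rewrite totC /tot_fun /= /homel_fam.
by case: ifP; rewrite ?gmulZ ?scaler0.
Qed.

Lemma homel_gmul a c (u : M a) : dle a c ->
  homel (gmul M a c u) = 'X_[[multinom `|c k - a k|%N | k < n]] *: homel u.
Proof.
move=> /forallP ac; set b := [multinom _ | k < n].
have cab : subdeg c b = a.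
  by apply/funext => k; rewrite /subdeg mnmE; have := ac k; lia.
apply: totP => e; rewrite totX /mon_shift /tot_fun /= /homel_fam.
have -> : `[< a = subdeg e b >] = `[< c = e >].
  apply/asbool_equiv_eq; split=> [E|<- //]; apply/funext => k.
  have := congr1 (fun d => d k) E; rewrite -cab /subdeg.
  exact: addIr.
case: asboolP => [<-|_]; last by rewrite gmul0.
by rewrite gmul_id gmul_comp ?dle_subdeg // cab dle_refl.
Qed.

Lemma scale_mon_stable (N : tot -> Prop) m v : stable_upto n N -> N v -> N ('X_[m] *: v).
Proof.
move=> sN; rewrite mpolyXE_id; move: v.
apply: (big_ind (fun g : {mpoly K[n]} => forall v, N v -> N (g *: v))) => [v|f g Nf Ng v|k _].
- by rewrite scale1r.
- by rewrite -scalerA => /Ng/Nf.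
elim: (m k) => [|e IH] v Nv; first by rewrite expr0 scale1r.
by rewrite exprS -scalerA; apply: (stableX sN) => //; apply: IH.
Qed.

Lemma tot_homel_ind (N : tot -> Prop) : N 0 -> (forall u v, N u -> N v -> N (u + v)) ->
  (forall a (u : M a), N (homel u)) -> forall v, N v.
Proof.
move=> N0 ND Nh v; have /finsuppP[s] := tot_finsupp v.
elim: s v => [|a s IH] v vs.
  by have -> : v = 0 by apply: totP => a; apply/eqP/negPn/negP => /vs.
rewrite -(subrK (homel (v a)) v); apply: ND => //; apply: IH => c.
rewrite totD -scaleN1r -mpolyC1 -mpolyCN totC scaleN1r.
have [->|ca] := eqVneq c a; first by rewrite homelE subrr eqxx.
have -> : homel (v a) c = 0.
  by rewrite /tot_fun /= /homel_fam asboolF // => /esym/eqP; rewrite (negPf ca).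
by rewrite subr0 => /vs; rewrite inE (negPf ca).
Qed.

Lemma noetherian_tot : fin_gen M -> noetherian tot.
Proof.
move=> [s [d [g gP]]].
apply: (noetherian_of_span (G := [seq homel (g l) | l <- enum 'I_s])).
have sN := stable_span_upto [seq homel (g l) | l <- enum 'I_s] n.
apply: tot_homel_ind; [exact: stable0 sN|exact: stableD sN|move=> a u].
have [c ->] := gP a u.
have -> : homel (\sum_(l < s | dle (d l) a) c l *: gmul M (d l) a (g l))
    = \sum_(l < s | dle (d l) a) (c l)%:MP *: homel (gmul M (d l) a (g l)).
  rewrite (big_morph (@homel a) (@homelD a) (id1 := 0)).
    by apply: eq_bigr => l _; rewrite homelZ.
  by rewrite -(scale0r 0) homelZ mpolyC0 scale0r.
apply: (big_ind (span_upto _ n)); [exact: stable0 sN|exact: stableD sN|move=> l la].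
apply: (stableZ sN); rewrite homel_gmul //; apply: scale_mon_stable => //.
by apply/Span_mem/map_f; rewrite mem_enum.
Qed.

Lemma seq_mult_in_idealmod fs (v : tot) : seq_mult fs v <-> in_idealmod fs v.
Proof.
split=> [[gs ->]|[gs [gsf vE]]].
  exists (fun j => tot_fun (gs j)); split=> [j|a]; first exact: tot_finsupp.
  by rewrite tot_sum.
exists (fun j => Tot (asboolT (gsf j))); apply: totP => a.
by rewrite vE tot_sum.
Qed.

(** A nonzero component lies above the degree of some generator, so total degrees are bounded below
    and the descent to smaller degrees stops. *)
Lemma exists_minimal_degree : fin_gen M -> nonzero M ->
  exists2 a, exists u : M a, u != 0 &
  forall b : 'X_{1..n}, b != 0%MM -> forall u : M (subdeg a b), u = 0.
Proof.
move=> [s [d [g gP]]] [a0 [v0 v0n]].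
pose wt (a : deg n) : int := \sum_k a k.
pose lo : int := - \sum_(l < s) `|wt (d l)|.
have loP a (u : M a) : u != 0 -> lo <= wt a.
  move=> un; have [c uE] := gP a u.
  have [l la] : exists l, dle (d l) a.
    apply: contrapT => nl; move/eqP: un; apply; rewrite uE big1 // => l la.
    by case: nl; exists l.
  have : wt (d l) <= wt a by apply: ler_sum => k _; apply: (forallP la).
  have : `|wt (d l)| <= \sum_(l < s) `|wt (d l)|.
    rewrite (bigD1 l) //= lerDl; apply: sumr_ge0 => k _.
    exact: normr_ge0.
  by move=> /lerNnormlW lo_le /(le_trans lo_le).
have [N ltN] : exists N : nat, wt a0 - lo < N%:Z by exists `|wt a0 - lo|.+1; lia.
elim: N a0 v0 v0n ltN => [|N IH] a v vn ltN; first by have := loP a v vn; lia.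
case: (pselect (exists b, b != 0%MM /\ exists u : M (subdeg a b), u != 0)).
  move=> [b [b0 [u un]]]; apply: (IH _ u un).
  have [k bk] : exists k, b k != 0%N.
    apply: contrapT => nk; move/eqP: b0; apply; apply/mnmP => k; rewrite mnm0E.
    by apply/eqP/negPn/negP => bk; apply: nk; exists k.
  have [S S0 wtE] : exists2 S : int, 0 <= S & wt a = wt (subdeg a b) + ((b k)%:Z + S).
    exists (\sum_(l < n | l != k) (b l)%:Z); first exact: sumr_ge0.
    transitivity (wt (subdeg a b) + \sum_l (b l)%:Z); last by rewrite (bigD1 k).
    by rewrite /wt -big_split; apply: eq_bigr => l _; rewrite /= /subdeg subrK.
  by move: wtE ltN; generalize (wt a) (wt (subdeg a b)) lo; lia.
move=> nb; exists a; first by exists v.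
move=> b b0 u; apply/eqP/negPn/negP => un; apply: nb; exists b; split=> //.
by exists u.
Qed.

(** Graded Nakayama: polynomials without constant term raise degrees, so they cannot produce an
    element of a minimal nonzero degree. *)
Lemma idealmod_proper fs : fin_gen M -> nonzero M -> {in fs, forall f, f@_0%MM = 0} ->
  exists v : forall a, M a, finsupp v /\ ~ in_idealmod fs v.
Proof.
move=> fgM nzM fs0; have [a [u un] aP] := exists_minimal_degree fgM nzM.
exists (homel u); split; first exact: tot_finsupp.
case=> gs [_ /(_ a)]; rewrite homelE => uE; move/eqP: un; apply.
rewrite uE big1 // => j _; rewrite /polyact big_seq big1 // => b bf.
rewrite (aP b _ (gs j (subdeg a b))) ?gmul0 ?scaler0 //.
apply: contraTneq bf => ->; rewrite -mcoeff_eq0 fs0 //.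
exact: mem_nth.
Qed.

Lemma regseqE fs : fin_gen M -> nonzero M ->
  regseq M fs <-> {in fs, forall f, f@_0%MM = 0} /\ weak_regular tot fs.
Proof.
move=> fgM nzM; split=> [[fs0 reg _]|[fs0 wreg]].
  split=> // i v; rewrite !seq_mult_in_idealmod.
  exact/reg/tot_finsupp.
split=> // [i v vf|]; last exact: idealmod_proper.
have := wreg i (Tot (asboolT vf)); rewrite /regular_mod !seq_mult_in_idealmod.
by [].
Qed.
End TotalModule.

(** * Invariance of depth under the shift *)

Lemma pbP (P : Prop) : reflect P (pb P).
Proof. by rewrite /pb; case: ClassicalEpsilon.excluded_middle_informative => h; constructor. Qed.

(** * The two sections of the degree map *)

Section Skip.
Variables (n : nat) (i : 'I_n) (j : int).

(** In direction [i], [sigma] identifies the degrees [j - 1] and [j]. Its two increasing sections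
    omit one of them, and are [skip j] and [skip (j - 1)]. *)
Definition skip (c : int) (a : deg n) : deg n :=
  fun k => if k == i then (if c <= a k then a k + 1 else a k) else a k.

Lemma skip_mono c a b : dle a b -> dle (skip c a) (skip c b).
Proof. by move=> /forallP ab; apply/forallP => k; have := ab k; rewrite /skip; case: (k == i) => //; do 2!case: ifP; lia. Qed.

(** An adjunction, which says where the generators of the shift have to be placed. *)
Lemma dle_skip a b : dle (skip j a) b = dle a (sigma i j b).
Proof.
apply: eq_forallb => k; rewrite /skip /sigma; case: eqP => // _; do 2!case: ifP; lia.
Qed.

Lemma skip_neq c a : skip c a i != c.
Proof. by rewrite /skip eqxx; case: ifP; lia. Qed.

Lemma sigma_subdeg a k : k != i -> sigma i j (subdeg a U_(k)%MM) = subdeg (sigma i j a) U_(k)%MM.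
Proof.
move=> ki; apply/funext => l; rewrite /sigma /subdeg mnm1E.
by case: (eqVneq l i) => // ->; rewrite (negPf ki) !subr0.
Qed.

Lemma skip_subdeg c a k : k != i -> skip c (subdeg a U_(k)%MM) = subdeg (skip c a) U_(k)%MM.
Proof.
move=> ki; apply/funext => l; rewrite /skip /subdeg mnm1E.
by case: (eqVneq l i) => // ->; rewrite (negPf ki) !subr0.
Qed.

Lemma subdeg_neq (a : deg n) k : k != i -> subdeg a U_(k)%MM i = a i.
Proof. by move=> ki; rewrite /subdeg mnm1E (negPf ki) subr0. Qed.

Lemma subdeg_eq (a : deg n) : subdeg a U_(i)%MM i = a i - 1.
Proof. by rewrite /subdeg mnm1E eqxx. Qed.

Lemma sigma_subdeg_i a : a i != j ->
  sigma i j (subdeg a U_(i)%MM) = subdeg (sigma i j a) U_(i)%MM.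
Proof.
move=> aj; apply/funext => l; rewrite /sigma /subdeg mnm1E eq_sym.
by case: (eqVneq i l) => // <-; do 2!case: ifP; lia.
Qed.

Lemma skip_subdeg_i a : skip (j - 1) (subdeg a U_(i)%MM) = subdeg (skip j a) U_(i)%MM.
Proof.
apply/funext => l; rewrite /skip /subdeg mnm1E eq_sym.
by case: (eqVneq i l) => // <-; do 2!case: ifP; lia.
Qed.

Lemma subdegK (a : deg n) b : subdeg (adddeg a b) b = a.
Proof. by apply/funext => k; rewrite /subdeg /adddeg addrK. Qed.

Lemma adddegK (a : deg n) b : adddeg (subdeg a b) b = a.
Proof. by apply/funext => k; rewrite /subdeg /adddeg subrK. Qed.

Lemma adddeg_subdegC (a : deg n) b b' : adddeg (subdeg a b) b' = subdeg (adddeg a b') b.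
Proof. by apply/funext => k; rewrite /subdeg /adddeg addrAC. Qed.

Lemma sigma_adddeg (a : deg n) : a i = j - 1 -> sigma i j (adddeg a U_(i)%MM) = sigma i j a.
Proof.
move=> aj; apply/funext => l; rewrite /sigma /adddeg mnm1E eq_sym.
case: (eqVneq i l) => [<-|_]; last by rewrite addr0.
by do 2!case: ifP; lia.
Qed.

Lemma skipK c a : (c == j) || (c == j - 1) -> sigma i j (skip c a) = a.
Proof.
move=> cj; apply/funext => l; rewrite /sigma /skip; case: eqP => // ->; do !case: ifP; lia.
Qed.

Lemma sigmaK c a : (c == j) || (c == j - 1) -> a i != c -> skip c (sigma i j a) = a.
Proof.
move=> cj ac; apply/funext => l; rewrite /sigma /skip; case: eqP => // ->; do !case: ifP; lia.
Qed.
End Skip.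

(** * Comparison of the total modules of [M] and its shift *)

Section ShiftMaps.
Variables (K : fieldType) (n : nat) (M : grmod K n) (i : 'I_n) (j : int).
Local Notation M' := (shiftmod M i j).
Local Notation sg := (sigma i j).
Local Notation sk := (skip i).

(** Rewriting a degree inside [v] and [gmul] at once avoids casts between components. *)
Lemma gmul_eqdeg (v : forall a, M a) a b c : a = b -> gmul M a c (v a) = gmul M b c (v b).
Proof. by move->. Qed.

Lemma gmul_eqdeg' (v : forall a, M' a) a b c :
  a = b -> gmul M (sg a) c (v a) = gmul M (sg b) c (v b).
Proof. by move->. Qed.

Lemma dle_eq (a b : deg n) : a = b -> dle a b.
Proof. by move->; apply: dle_refl. Qed.

(** The embedding leaves the hyperplane [a i = c] empty. For multiplication by [x_i], the source
    uses [c = j - 1] and the target [c = j], because [x_i] carries the one hyperplane to the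
    other. *)
Definition emb_fam (c : int) (v : tot M) : fam M' :=
  fun a => if a i == c then 0 else v (sg a).
Definition ret_fam (c : int) (w : tot M') : fam M :=
  fun a => gmul M (sg (sk c a)) a (w (sk c a)).
(** The inverse of the isomorphism [x_i] from the hyperplane [a i = j - 1] to [a i = j], extended by
    zero. *)
Definition rho_fam (w : tot M') : fam M' :=
  fun a => if a i == j - 1 then
    gmul M (sg (adddeg a U_(i)%MM)) (sg a) (w (adddeg a U_(i)%MM)) else 0.

Section Skipped.
Variable c : int.
Hypothesis cj : (c == j) || (c == j - 1).

Fact emb_supp v : finsuppb (emb_fam c v).
Proof.
have /finsuppP[s sP] := tot_finsupp v.
apply/asboolP/finsuppP; exists (map (sk c) s) => a; rewrite /emb_fam.
case: (boolP (a i == c)) => [|ac]; first by rewrite eqxx.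
by move=> /sP vs; apply/mapP; exists (sg a) => //; rewrite sigmaK.
Qed.

Fact ret_supp w : finsuppb (ret_fam c w).
Proof.
have /finsuppP[s sP] := tot_finsupp w.
apply/asboolP/finsuppP; exists (map sg s) => a nz.
apply/mapP; exists (sk c a); last by rewrite skipK.
by apply: sP; apply: contraNneq nz; rewrite /ret_fam => ->; rewrite gmul0.
Qed.
End Skipped.

Fact rho_supp w : finsuppb (rho_fam w).
Proof.
have /finsuppP[s sP] := tot_finsupp w.
apply/asboolP/finsuppP; exists (map (fun a => subdeg a U_(i)%MM) s) => a.
rewrite /rho_fam; case: ifP => _; last by rewrite eqxx.
move=> nz; apply/mapP; exists (adddeg a U_(i)%MM); last by rewrite subdegK.
by apply: sP; apply: contraNneq nz => ->; rewrite gmul0.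
Qed.

Fact skips_low : (j - 1 == j) || (j - 1 == j - 1). Proof. by rewrite eqxx orbT. Qed.
Fact skips_high : (j == j) || (j == j - 1). Proof. by rewrite eqxx. Qed.

Definition emb c cj v : tot M' := Tot (@emb_supp c cj v).
Definition ret c cj w : tot M := Tot (@ret_supp c cj w).
Definition rho w : tot M' := Tot (rho_supp w).

Lemma embE c cj v a : @emb c cj v a = if a i == c then 0 else v (sg a).
Proof. by []. Qed.
Lemma retE c cj w a : @ret c cj w a = gmul M (sg (sk c a)) a (w (sk c a)).
Proof. by []. Qed.
Lemma rhoE w a : rho w a = if a i == j - 1 then
    gmul M (sg (adddeg a U_(i)%MM)) (sg a) (w (adddeg a U_(i)%MM)) else 0.
Proof. by []. Qed.

Lemma totXi k (v : tot M) a : ('X_k *: v) a = gmul M (subdeg a U_(k)%MM) a (v (subdeg a U_(k)%MM)).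
Proof. exact: totX. Qed.
Lemma totXi' k (w : tot M') a : ('X_k *: w) a =
  gmul M (sg (subdeg a U_(k)%MM)) (sg a) (w (subdeg a U_(k)%MM)).
Proof. exact: totX. Qed.

Lemma emb_add c cj : {morph @emb c cj : u v / u + v}.
Proof. by move=> u v; apply: totP => a; rewrite totD !embE; case: ifP; rewrite ?addr0. Qed.

Lemma ret_add c cj : {morph @ret c cj : u v / u + v}.
Proof. by move=> u v; apply: totP => a; rewrite totD !retE -gmulD. Qed.

Lemma rho_add : {morph rho : u v / u + v}.
Proof.
move=> u v; apply: totP => a; rewrite totD !rhoE; case: ifP; rewrite ?addr0 // => _.
by rewrite -gmulD.
Qed.

Lemma emb_X c cj k : k != i -> {morph @emb c cj : v / 'X_k *: v}.
Proof.
move=> ki v; apply: totP => a; rewrite totXi' !embE subdeg_neq //.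
case: ifP => _; first by rewrite gmul0.
by rewrite totXi; apply/esym/gmul_eqdeg/sigma_subdeg.
Qed.

Lemma ret_X c cj k : k != i -> {morph @ret c cj : v / 'X_k *: v}.
Proof.
move=> ki w; apply: totP => a; rewrite totXi !retE totXi'.
rewrite !gmul_comp ?dle_subdeg ?(dle_eq (skipK _ _ _)) ?sigma_mono ?dle_subdeg //.
by apply/gmul_eqdeg'; rewrite skip_subdeg.
Qed.

Lemma rho_X k : k != i -> {morph rho : v / 'X_k *: v}.
Proof.
move=> ki w; apply: totP => a; rewrite totXi' !rhoE subdeg_neq //.
case: eqP => [ai|_]; last by rewrite gmul0.
have dl : dle (sg (adddeg a U_(i)%MM)) (sg a) by exact/dle_eq/sigma_adddeg.
have dr : dle (sg (adddeg (subdeg a U_(k)%MM) U_(i)%MM)) (sg (subdeg a U_(k)%MM)).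
  by apply/dle_eq/sigma_adddeg; rewrite subdeg_neq.
rewrite totXi' !gmul_comp ?dl ?dr ?sigma_mono ?dle_subdeg //.
by apply/gmul_eqdeg'; rewrite adddeg_subdegC.
Qed.

Lemma embK c cj : cancel (@emb c cj) (@ret c cj).
Proof.
move=> v; apply: totP => a; rewrite retE embE (negPf (skip_neq _ _ _)).
by rewrite -[RHS]gmul_id; apply: gmul_eqdeg; apply: skipK.
Qed.

Lemma X_emb v : 'X_i *: emb skips_low v = emb skips_high ('X_i *: v).
Proof.
apply: totP => a; rewrite totXi' !embE subdeg_eq (inj_eq (addIr _)).
case: eqP => [_|/eqP aj]; first by rewrite gmul0.
by rewrite totXi; apply/gmul_eqdeg/sigma_subdeg_i.
Qed.

Lemma X_ret w : 'X_i *: ret skips_low w = ret skips_high ('X_i *: w).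
Proof.
apply: totP => a; rewrite totXi !retE totXi'.
rewrite !gmul_comp ?dle_subdeg ?sigma_mono ?dle_subdeg ?(dle_eq (skipK _ _ _)) ?skips_low ?skips_high //.
by apply/gmul_eqdeg'/skip_subdeg_i.
Qed.

Lemma emb_ret_low w : emb skips_low (ret skips_low w) + rho ('X_i *: w) = w.
Proof.
apply: totP => a; rewrite totD embE rhoE retE.
case: eqP => [ai|/eqP ai]; last first.
  rewrite addr0 -[RHS](gmul_id (g := M)).
  by apply/gmul_eqdeg'/sigmaK => //; exact: skips_low.
have dl : dle (sg (adddeg a U_(i)%MM)) (sg a) by exact/dle_eq/sigma_adddeg.
rewrite add0r totXi' gmul_comp ?dl ?sigma_mono ?dle_subdeg //.
by rewrite -[RHS](gmul_id (g := M)); apply/gmul_eqdeg'/subdegK.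
Qed.

Lemma emb_ret_high w : emb skips_high (ret skips_high w) + 'X_i *: rho w = w.
Proof.
apply: totP => a; rewrite totD embE totXi' rhoE retE subdeg_eq (inj_eq (addIr _)).
case: eqP => [ai|/eqP ai]; last first.
  rewrite gmul0 addr0 -[RHS](gmul_id (g := M)).
  by apply/gmul_eqdeg'/sigmaK => //; exact: skips_high.
have dl : dle (sg (adddeg (subdeg a U_(i)%MM) U_(i)%MM)) (sg (subdeg a U_(i)%MM)).
  by apply/dle_eq/sigma_adddeg; rewrite subdeg_eq ai.
rewrite add0r gmul_comp ?dl ?sigma_mono ?dle_subdeg //.
by rewrite -[RHS](gmul_id (g := M)); apply/gmul_eqdeg'/adddegK.
Qed.

(** The variable [x_i] comes first so that the outermost cone is the one on [x_i]; the other
    variables commute with all five maps. *)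
Lemma exact_at_shiftmod p :
  let xs := [seq 'X_k | k <- i :: rem i (enum 'I_n)] : seq {mpoly K[n]} in
  exact_at xs (fun v : tot M => v = 0) p <-> exact_at xs (fun w : tot M' => w = 0) p.
Proof.
have Xi f : (forall k, k != i -> f ('X_k : {mpoly K[n]})) ->
    {in [seq 'X_k | k <- rem i (enum 'I_n)], forall y : {mpoly K[n]}, f y : Prop}.
  move=> fX y /mapP[k]; rewrite mem_rem_uniq ?enum_uniq // => /andP[ki _] ->.
  exact: fX.
apply: (exact_at_cone_retract (a := emb skips_low) (b := emb skips_high) (a' := ret skips_low)
  (b' := ret skips_high) (rho := rho)).
- exact: emb_add.
- exact: emb_add.
- exact: ret_add.
- exact: ret_add.
- exact: rho_add.
- by apply: Xi => k; apply: emb_X.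
- by apply: Xi => k; apply: emb_X.
- by apply: Xi => k; apply: ret_X.
- by apply: Xi => k; apply: ret_X.
- by apply: Xi => k; apply: rho_X.
- exact: embK.
- exact: embK.
- exact: X_emb.
- exact: X_ret.
- exact: emb_ret_low.
- exact: emb_ret_high.
Qed.

Lemma fin_gen_shiftmod : fin_gen M -> fin_gen M'.
Proof.
move=> [s [d [g gP]]]; exists s, (fun l => sk j (d l)).
exists (fun l => gmul M (d l) (sg (sk j (d l))) (g l)) => a v.
have [c vE] := gP (sg a) v; exists c; rewrite {1}vE.
apply: eq_big => [l|l dl]; first by rewrite dle_skip.
congr (_ *: _); rewrite [RHS]gmul_comp //; first by rewrite dle_eq // skipK ?skips_high.
by apply: sigma_mono; rewrite dle_skip.
Qed.

Lemma nonzero_shiftmod : nonzero M -> nonzero M'.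
Proof.
move=> [a [v vn]]; exists (sk j a), (gmul M a (sg (sk j a)) v).
apply: contraNneq vn => /(congr1 (gmul M (sg (sk j a)) a)).
have E := skipK i a skips_high.
by rewrite gmul_comp ?dle_eq // gmul0 gmul_id => ->.
Qed.
End ShiftMaps.

(** * Depth in terms of Koszul cohomology *)

Section Depth.
Variables (K : fieldType) (n : nat).

Lemma in_ideal_vars (i : 'I_n) (f : {mpoly K[n]}) :
  in_ideal [seq 'X_k | k <- i :: rem i (enum 'I_n)] f <-> f@_0%MM = 0.
Proof.
split.
  move: (i :: _) => ks; elim: ks f => [f ->|k ks IH f [h [f' [-> /IH f'0]]]].
    by rewrite mcoeff0.
  rewrite mcoeffD f'0 addr0 rmorphM /= mcoeffX.
  by rewrite (_ : (U_(k) == 0)%MM = false) ?mulr0 // mnm1_eq0.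
move=> f0; rewrite [f]mpolyE big_seq.
apply: (big_ind (in_ideal _)) => [|g h|b bf]; [exact: in_ideal0|exact: in_idealD|].
have [k bk] : exists k, b k != 0%N.
  apply: contrapT => nk; move: bf; rewrite mcoeff_msupp (_ : b = 0%MM) ?f0 ?eqxx //.
  by apply/mnmP => k; rewrite mnm0E; apply/eqP/negPn/negP => bk; apply: nk; exists k.
rewrite -mul_mpolyC; apply: in_idealM.
have -> : b = (b - U_(k) + U_(k))%MM by rewrite submK // lep1mP.
rewrite mpolyXD; apply: in_idealM; apply/mem_in_ideal/mapP; exists k => //.
by rewrite inE mem_rem_uniq ?enum_uniq // inE mem_enum; case: eqP.
Qed.

Lemma exists_regseqE (M : grmod K n) (i : 'I_n) (r : nat) : fin_gen M -> nonzero M ->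
  (exists fs, size fs = r /\ regseq M fs) <->
  forall p : int, p < r%:Z ->
    exact_at [seq 'X_k | k <- i :: rem i (enum 'I_n)] (fun v : tot M => v = 0) p.
Proof.
move=> fgM nzM; rewrite -regular_seq_koszul; last exact: noetherian_tot.
split=> [[fs [szfs /regseqE[] // fs0 wreg]]|[fs [szfs Ifs wreg]]]; exists fs.
  by split=> // f /fs0 ?; apply/in_ideal_vars.
by split=> //; apply/regseqE => //; split=> // f /Ifs/in_ideal_vars.
Qed.

Lemma depth_shiftmod (M : grmod K n) (i : 'I_n) (j : int) : fin_gen M -> nonzero M ->
  depth (shiftmod M i j) = depth M.
Proof.
move=> fgM nzM; apply: eq_bigl => r.
have fgM' := fin_gen_shiftmod i j fgM; have nzM' := nonzero_shiftmod i j nzM.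
apply/pbP/pbP => [/(exists_regseqE i _ fgM' nzM') ex|/(exists_regseqE i _ fgM nzM) ex].
  apply/(exists_regseqE i _ fgM nzM) => p ltp.
  exact: (exact_at_shiftmod M i j p).2 (ex p ltp).
apply/(exists_regseqE i _ fgM' nzM') => p ltp.
exact: (exact_at_shiftmod M i j p).1 (ex p ltp).
Qed.
End Depth.

(** * Stanley depth *)

Section StanleyDepth.
Variables (K : fieldType) (n : nat).

(** Repeating or dropping cones cannot lower the minimum; if none is left, the default value [n]
    bounds every such minimum. *)
Lemma sdec_depth_reindex s s' (Z : 'I_s -> {set 'I_n}) (f : 'I_s' -> 'I_s) :
  (sdec_depth Z <= sdec_depth (Z \o f))%N.
Proof.
have leF (T : Type) (F : T -> nat) (r : seq T) : (\big[minn/n]_(l <- r) F l <= n)%N.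
  by elim/big_rec: _ => // l x _; rewrite geq_min orbC => ->.
apply: (big_ind (fun x => sdec_depth Z <= x)%N) => [|x y lex ley|l _ /=].
- exact: leF.
- by rewrite leq_min lex.
rewrite /sdec_depth; move: (mem_index_enum (f l)).
elim: (index_enum _) => // k r IH; rewrite inE big_cons geq_min => /orP[/eqP->|/IH->].
  by rewrite leqnn.
by rewrite orbT.
Qed.

Lemma sdepth_le (M M' : grmod K n) :
  (forall s d (m : forall l : 'I_s, M (d l)) Z, stanley_dec m Z ->
   exists s' d' (m' : forall l : 'I_s', M' (d' l)) f, stanley_dec m' (Z \o f)) ->
  (sdepth M <= sdepth M')%N.
Proof.
move=> H; apply/bigmax_leqP => r /pbP[s [d [m [Z [dec le_r]]]]].
apply: (leq_bigmax_cond (F := fun r : 'I_n.+1 => r : nat)).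
apply/pbP; have [s' [d' [m' [f dec']]]] := H s d m Z dec.
exists s', d', m', (Z \o f); split=> //.
exact: leq_trans le_r (sdec_depth_reindex _ _).
Qed.

Lemma in_cone_dle (d : deg n) Z a : in_cone d Z a -> dle d a.
Proof. by move=> /forallP h; apply/forallP => k; case/andP: (h k). Qed.

Lemma in_cone_base (d : deg n) Z : in_cone d Z d.
Proof. by apply/forallP => k; rewrite lexx eqxx orbT. Qed.

(* If the preimage under [q] of every cone of the decomposition is the
   disjoint union of the cones indexed by the fibre of [f], the pieces pull
   back to a decomposition. *)
Lemma stanley_dec_pullback (M : grmod K n) q
    (qm : forall a c, dle a c -> dle (q a) (q c)) s d
    (m : forall l : 'I_s, M (d l)) Z s' (d' : 'I_s' -> deg n) (f : 'I_s' -> 'I_s) :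
  (forall t a, in_cone (d' t) (Z (f t)) a -> in_cone (d (f t)) (Z (f t)) (q a)) ->
  (forall l a, in_cone (d l) (Z l) (q a) ->
     exists2 t, f t = l /\ in_cone (d' t) (Z (f t)) a &
     forall u, f u = l -> in_cone (d' u) (Z (f u)) a -> u = t) ->
  stanley_dec m Z ->
  @stanley_dec K n (pullback qm M) s' d'
    (fun t => gmul M (d (f t)) (q (d' t)) (m (f t))) (Z \o f).
Proof.
move=> sub uniq [free dec].
have mulE t a : in_cone (d' t) (Z (f t)) a ->
    gmul M (q (d' t)) (q a) (gmul M (d (f t)) (q (d' t)) (m (f t)))
    = gmul M (d (f t)) (q a) (m (f t)).
  move=> ta; apply: gmul_comp; last exact/qm/(in_cone_dle ta).
  exact/in_cone_dle/sub/in_cone_base.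
have sumE a (c : 'I_s' -> K) :
    \sum_(t < s' | in_cone (d' t) (Z (f t)) a) c t *:
      gmul M (q (d' t)) (q a) (gmul M (d (f t)) (q (d' t)) (m (f t)))
  = \sum_(l < s | in_cone (d l) (Z l) (q a))
      (\sum_(t < s' | in_cone (d' t) (Z (f t)) a && (f t == l)) c t) *:
      gmul M (d l) (q a) (m l).
  rewrite (partition_big f (fun l => in_cone (d l) (Z l) (q a))) => [|t]; last exact: sub.
  apply: eq_bigr => l _; rewrite scaler_suml.
  by apply: eq_bigr => t /andP[ta /eqP ft]; rewrite mulE // -ft.
(* The new cones over a given [l] are disjoint, so at most one coefficient survives in degree
   [a]. *)
have one a (c : 'I_s' -> K) t : in_cone (d' t) (Z (f t)) a ->
    \sum_(u < s' | in_cone (d' u) (Z (f u)) a && (f u == f t)) c u = c t.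
  move=> ta; rewrite (big_pred1 t) // => u; apply/andP/eqP => [[ua /eqP fu]|->] //.
  have [t' [_ _] tP] := uniq _ _ (sub _ _ ta).
  by rewrite (tP u) // (tP t).
split=> [t a /= ta|a].
  by rewrite mulE //; apply/free/sub.
split=> [v|c] /=.
  have [c vE] := (dec (q a)).1 v; exists (fun t => c (f t)).
  rewrite sumE {1}vE; apply: eq_bigr => l la; congr (_ *: _).
  by have [t [<- ta] _] := uniq l a la; rewrite (one a (fun t => c (f t))).
rewrite sumE => /((dec (q a)).2 _) c0 t ta.
by rewrite -(one a c t ta) c0 //; apply: sub.
Qed.

Lemma stanley_dec_pullback_fin (M : grmod K n) q
    (qm : forall a c, dle a c -> dle (q a) (q c)) s d
    (m : forall l : 'I_s, M (d l)) Z (T : finType) (d' : T -> deg n) (f : T -> 'I_s) :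
  (forall t a, in_cone (d' t) (Z (f t)) a -> in_cone (d (f t)) (Z (f t)) (q a)) ->
  (forall l a, in_cone (d l) (Z l) (q a) ->
     exists2 t, f t = l /\ in_cone (d' t) (Z (f t)) a &
     forall u, f u = l -> in_cone (d' u) (Z (f u)) a -> u = t) ->
  stanley_dec m Z ->
  exists s' d' (m' : forall l : 'I_s', pullback qm M (d' l)) f, stanley_dec m' (Z \o f).
Proof.
move=> sub uniq dec.
exists #|T|, (d' \o enum_val); eexists; exists (f \o enum_val).
apply: (stanley_dec_pullback qm (d' := d' \o enum_val) (f := f \o enum_val)) dec.
  by move=> t a; apply: sub.
move=> l a /uniq[t tl tP]; exists (enum_rank t); rewrite /= ?enum_rankK // => u fu ua.
by rewrite -(tP _ fu ua) enum_valK.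
Qed.

(** [sigma] after [skip] is the identity only up to a proved equality; substituting it makes the
    components convertible to those of [M]. *)
Lemma stanley_dec_id (M : grmod K n) q (qm : forall a c, dle a c -> dle (q a) (q c))
    s d (m : forall l : 'I_s, pullback qm M (d l)) Z : q = id ->
  stanley_dec m Z -> exists m' : forall l, M (d l), stanley_dec m' Z.
Proof. by move=> E; subst q; exists m. Qed.

(** * Preimages of cones under [sigma] and [skip] *)

Section Shift.
Variables (M : grmod K n) (i : 'I_n) (j : int).

Definition in_cone_off (d : deg n) (Z : {set 'I_n}) (a : deg n) :=
  [forall k, (k != i) ==> (d k <= a k) && ((k \in Z) || (a k == d k))].

Lemma in_coneE d Z a : in_cone d Z a =
  in_cone_off d Z a && ((d i <= a i) && ((i \in Z) || (a i == d i))).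
Proof.
apply/forallP/andP => [h|[/forallP h hi] k]; last first.
  by have [->|ki] := eqVneq k i; [exact: hi|have := h k; rewrite ki].
by split; [apply/forallP => k; apply/implyP => _|]; apply: h.
Qed.

Lemma in_cone_off_eq d d' Z a a' :
  (forall k, k != i -> d k = d' k) -> (forall k, k != i -> a k = a' k) ->
  in_cone_off d Z a = in_cone_off d' Z a'.
Proof.
move=> dd aa; apply: eq_forallb => k.
by case: (boolP (k != i)) => //= ki; rewrite dd ?aa.
Qed.

Lemma skip_off c (a : deg n) k : k != i -> skip i c a k = a k.
Proof. by rewrite /skip => /negPf->. Qed.

Lemma sigma_off c (a : deg n) k : k != i -> sigma i c a k = a k.
Proof. by rewrite /sigma => /negPf->. Qed.

(* The preimage of a cone under [sigma] is a cone, or two if the cone is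
   contained in the hyperplane of degree [j - 1] in direction [i]; [b] selects
   the second one. *)
Lemma in_cone_sigma (d : deg n) (Z : {set 'I_n}) a (b : bool) : b ==> (i \notin Z) && (d i == j - 1) ->
  in_cone (skip i (if b then j - 1 else j) d) Z a =
  in_cone d Z (sigma i j a) &&
    (b == [&& i \notin Z, d i == j - 1 & a i == j]).
Proof.
move=> Pb; rewrite !in_coneE -andbA.
rewrite (@in_cone_off_eq (skip i _ d) d Z a (sigma i j a)); last first.
- by move=> k /sigma_off.
- by move=> k /skip_off.
congr (_ && _); rewrite /skip /sigma eqxx.
by case: b Pb; case: (i \in Z) => //=; do !case: ifP; lia.
Qed.

(** The least integer whose image under [skip j] is at least [d i] equals [d i] when [d i <= j] and
    [d i - 1] otherwise, whence the threshold [j + 1]. The excluded cones lie in the omitted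
    hyperplane and have empty preimage. *)
Lemma in_cone_skip (d : deg n) (Z : {set 'I_n}) a : (i \in Z) || (d i != j) ->
  in_cone (sigma i (j + 1) d) Z a = in_cone d Z (skip i j a).
Proof.
move=> Pd; rewrite !in_coneE.
rewrite (@in_cone_off_eq (sigma i _ d) d Z a (skip i j a)); last first.
- by move=> k /skip_off.
- by move=> k /sigma_off.
congr (_ && _); rewrite /skip /sigma eqxx.
by case: (i \in Z) Pd => //=; do !case: ifP; lia.
Qed.

Lemma sdepth_le_shiftmod : (sdepth M <= sdepth (shiftmod M i j))%N.
Proof.
apply: sdepth_le => s d m Z.
pose P (x : 'I_s * bool) := x.2 ==> (i \notin Z x.1) && (d x.1 i == j - 1).
apply: (stanley_dec_pullback_fin (@sigma_mono n i j) (T := {x | P x})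
  (d' := fun x => skip i (if (val x).2 then j - 1 else j) (d (val x).1))
  (f := fun x => (val x).1)).
  by move=> [[l b] /= Pb] a; rewrite in_cone_sigma // => /andP[].
move=> l a la.
have PB : P (l, [&& i \notin Z l, d l i == j - 1 & a i == j]).
  by apply/implyP => /and3P[-> ->].
exists (Sub _ PB); first by split; rewrite //= in_cone_sigma // la eqxx.
move=> [[l' b] /= Pb] El; subst l'; rewrite in_cone_sigma // => /andP[_ /eqP Eb].
by apply: val_inj; rewrite /= Eb.
Qed.

Lemma shiftmod_sdepth_le : (sdepth (shiftmod M i j) <= sdepth M)%N.
Proof.
apply: sdepth_le => s d m Z dec.
pose P l := (i \in Z l) || (d l i != j).
have [||s' [d' [m' [f dec']]]] := @stanley_dec_pullback_fin _ _ (@skip_mono n i j)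
  s d m Z {l | P l} (fun x => sigma i (j + 1) (d (val x))) val _ _ dec.
- by move=> [l Pl] a /=; rewrite in_cone_skip.
- move=> l a la.
  have Pl : P l.
    move: la; rewrite in_coneE => /and3P[_ _]; rewrite /P.
    by case: (i \in Z l) => //= /eqP <-; apply: skip_neq.
  exists (Sub l Pl); first by rewrite /= in_cone_skip.
  by move=> [l' Pl'] /= E _; apply: val_inj.
have idE : (fun a => sigma i j (skip i j a)) = id.
  by apply/funext => a; apply: skipK; rewrite eqxx.
pose qm a c (ac : dle a c) := sigma_mono i j (skip_mono i j ac).
(* The pullback of the shift along [skip] is, by computation, the pullback of [M] along the
   composite, so [dec'] applies as it stands. *)
have [|m'' dec''] := @stanley_dec_id M _ qm s' d' m' (Z \o f) idE; first exact: dec'.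
by exists s', d', m'', f.
Qed.
End Shift.
End StanleyDepth.

Theorem theorem3p2 (K : fieldType) (n : nat) (i : 'I_n) (j : int) (M : grmod K n) :
  fin_gen M -> nonzero M ->
  sdepth M = sdepth (shiftmod M i j) /\
  ((depth M <= sdepth M)%N <->
   (depth (shiftmod M i j) <= sdepth (shiftmod M i j))%N).
Proof.
move=> fgM nzM.
have -> : sdepth (shiftmod M i j) = sdepth M.
  by apply/eqP; rewrite eqn_leq shiftmod_sdepth_le sdepth_le_shiftmod.
by rewrite depth_shiftmod.
Qed.
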